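(* Consider an LTV system $\dot x(t)=A(t)x(t)+B(t)u(t)$, $y(t)=C(t)x(t)+D(t)u(t)$ on $\mathbb T$, with $A\in L^1_{\mathrm{loc}}(\mathbb T,\mathbb C^{n,n})$, $B\in L^2_{\mathrm{loc}}(\mathbb T,\mathbb C^{n,m})$, $C\in L^2_{\mathrm{loc}}(\mathbb T,\mathbb C^{m,n})$, $D\in L^\infty_{\mathrm{loc}}(\mathbb T,\mathbb C^{m,m})$. Let $Q\in\mathrm{BV}_{\mathrm{loc}}(\mathbb T,\mathbf S^n_+(\mathbb C))$ and $V_Q(t,x)=\frac12x^{\mathrm H}Q(t)x$. If $V_Q$ is a storage function for the system, then $Q$ is a solution of the differential KYP inequality $$\begin{bmatrix}-A^{\mathrm H}Q-QA-\dot Q& C^{\mathrm H}-QB\\ C-B^{\mathrm H}Q& D+D^{\mathrm H}\end{bmatrix}(t)\ge 0\quad\text{for a.e. }t\in\mathbb T,$$ where $\dot Q$ is the classical derivative, which exists a.e. Conversely, if $Q\in\mathrm{AUC}_{\mathrm{loc}}(\mathbb T,\mathbf S^n_+(\mathbb C))$ and $Q$ is a solution of this differential KYP inequality, then $V_Q$ is a storage function for the system.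
   Context: $\mathbb T\subseteq\mathbb R$ is an open (possibly unbounded) interval. $M^{\mathrm H}$ is the conjugate transpose; $\mathbf S^n(\mathbb C)$ and $\mathbf S^n_+(\mathbb C)$ are the sets of Hermitian and Hermitian positive semidefinite $n\times n$ matrices; $\le,\ge$ denote the Loewner order. $\mathrm{BV}_{\mathrm{loc}}(\mathbb T,\cdot)$ denotes (pointwise defined) matrix functions of finite total variation on every compact interval $[t_0,t_1]\subseteq\mathbb T$. A function $Q:[t_0,t_1]\to\mathbf S^n(\mathbb C)$ is absolutely upper semicontinuous, $Q\in\mathrm{AUC}([t_0,t_1],\mathbf S^n(\mathbb C))$, if the derivative $\dot Q(t)$ exists for a.e. $t\in(t_0,t_1)$, $\dot Q\in L^1([t_0,t_1],\mathbf S^n(\mathbb C))$, and $Q(s)-Q(r)\le\int_r^s\dot Q(t)\,\mathrm dt$ for all $r\le s$ in $[t_0,t_1]$ (equivalently, $Q$ is of bounded variation with singular part weakly decreasing in the Loewner order). $\mathrm{AUC}_{\mathrm{loc}}(\mathbb T,\mathbf S^n_+(\mathbb C))$ consists of the $Q:\mathbb T\to\mathbf S^n_+(\mathbb C)$ whose restriction to every compact $[t_0,t_1]\subseteq\mathbb T$ is absolutely upper semicontinuous. A state-input-output solution is a triple $(x,u,y)$ with $x\in W^{1,1}_{\mathrm{loc}}(\mathbb T,\mathbb C^n)$ (continuous representative), $u,y\in L^2_{\mathrm{loc}}(\mathbb T,\mathbb C^m)$ satisfying the system equations a.e. on $\mathbb T$. A storage function is a map $V:\mathbb T\times\mathbb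 C^n\to[0,\infty)$ with $V(t,0)=0$ for all $t\in\mathbb T$ and $V(t_1,x(t_1))-V(t_0,x(t_0))\le\int_{t_0}^{t_1}\mathrm{Re}(y(t)^{\mathrm H}u(t))\,\mathrm dt$ for all $t_0\le t_1$ in $\mathbb T$ and all state-input-output solutions $(x,u,y)$. *)

(* Defs.v *)
From HB Require Import structures.
From mathcomp Require Import all_boot all_order all_algebra.
From mathcomp Require Import all_classical all_reals all_analysis.
From mathcomp Require Import complex.

Set Implicit Arguments.
Unset Strict Implicit.
Unset Printing Implicit Defensive.

Import Order.TTheory GRing.Theory Num.Theory.
Import numFieldNormedType.Exports.

Local Open Scope classical_set_scope.
Local Open Scope ring_scope.
Local Open Scope complex_scope.
Local Open Scope sesquilinear_scope.

(* Functions on the interval T are total functions on R whose values outside T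
   are never used. *)

Section matrices.
Context {R : realType}.
Local Notation C := R[i].

(* On R[i], 0 <= z means that z is real and nonnegative. *)
Definition psdmx n (M : 'M[C]_n) : Prop :=
  M \is hermsymmx /\ forall v : 'cV[C]_n, 0 <= (v ^t* *m M *m v) 0 0.

Definition loewner_le n (M N : 'M[C]_n) : Prop := psdmx (N - M).

End matrices.

Section function_spaces.
Context {R : realType}.
Local Notation C := R[i].
Local Notation mu := (@lebesgue_measure R).

(* A property (resp. a functional) of real-valued functions is extended to
   complex matrix-valued ones by applying it to the real and imaginary parts of
   all entries. *)
Definition mx_all (P : (R -> R) -> Prop) p q (M : R -> 'M[C]_(p, q)) : Prop :=
  forall i j, P (fun t => complex.Re (M t i j)) /\
              P (fun t => complex.Im (M t i j)).

Definition mx_all2 (P : (R -> R) -> (R -> R) -> Prop) p q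
    (M N : R -> 'M[C]_(p, q)) : Prop :=
  forall i j,
    P (fun t => complex.Re (M t i j)) (fun t => complex.Re (N t i j)) /\
    P (fun t => complex.Im (M t i j)) (fun t => complex.Im (N t i j)).

Definition mx_app (F : (R -> R) -> R) p q (M : R -> 'M[C]_(p, q)) :
    'M[C]_(p, q) :=
  \matrix_(i, j) (F (fun t => complex.Re (M t i j)) +i*
                  F (fun t => complex.Im (M t i j))).

(* Elements of L^p are given by Borel measurable representatives, following the
   library. *)
Definition Lp_seg (r : \bar R) (a b : R) p q (M : R -> 'M[C]_(p, q)) : Prop :=
  mx_all (fun f => f \_ `[a, b] \in Lfun mu r) M.

Definition Lp_loc (r : \bar R) (T : set R) p q (M : R -> 'M[C]_(p, q)) : Prop :=
  forall a b, `[a, b] `<=` T -> Lp_seg r a b M.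

Definition BV_loc (T : set R) p q (M : R -> 'M[C]_(p, q)) : Prop :=
  forall a b, `[a, b] `<=` T -> mx_all (bounded_variation a b) M.

Definition mxderivable p q (M : R -> 'M[C]_(p, q)) (t : R) : Prop :=
  mx_all (fun f => derivable f t 1) M.

Definition mxderiv p q (M : R -> 'M[C]_(p, q)) (t : R) : 'M[C]_(p, q) :=
  mx_app (fun f => derive1 f t) M.

Definition mxintegral (a b : R) p q (M : R -> 'M[C]_(p, q)) : 'M[C]_(p, q) :=
  mx_app (fun f => \int[mu]_(t in `[a, b]) f t) M.

(* G is a representative of the class in L^1 of the derivative of Q, which is
   defined only almost everywhere. *)
Definition AUC n (a b : R) (Q : R -> 'M[C]_n) : Prop :=
  (forall t, a <= t <= b -> Q t \is hermsymmx) /\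
  exists G : R -> 'M[C]_n,
    [/\ Lp_seg 1%E a b G,
        {ae mu, forall t, a < t < b ->
           mxderivable Q t /\ mxderiv Q t = G t}
      & forall r s, a <= r -> r <= s -> s <= b ->
          loewner_le (Q s - Q r) (mxintegral r s G)].

Definition AUC_loc n (T : set R) (Q : R -> 'M[C]_n) : Prop :=
  forall a b, `[a, b] `<=` T -> AUC a b Q.

(* C^1 functions with compact support in the interval T, extended by 0. *)
Definition test_function (T : set R) (phi : R -> R) : Prop :=
  [/\ forall t, derivable phi t 1, continuous (derive1 phi)
    & exists a b, `[a, b] `<=` T /\ forall t, ~~ (a <= t <= b) -> phi t = 0].

Definition weak_derivative (T : set R) (f g : R -> R) : Prop :=
  forall phi, test_function T phi ->
    \int[mu]_(t in T) (f t * derive1 phi t) = - \int[mu]_(t in T) (g t * phi t).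

(* x is the continuous representative of an element of W^{1,1}_loc, with weak
   derivative dx. *)
Definition W11_loc (T : set R) p q (x dx : R -> 'M[C]_(p, q)) : Prop :=
  [/\ mx_all (fun f => {within T, continuous f}) x,
      Lp_loc 1%E T x, Lp_loc 1%E T dx & mx_all2 (weak_derivative T) x dx].

End function_spaces.

Section systems.
Context {R : realType} {n m : nat}.
Local Notation C := R[i].
Local Notation mu := (@lebesgue_measure R).
Variables (T : set R).
Variables (A : R -> 'M[C]_n) (B : R -> 'M[C]_(n, m)).
Variables (C_ : R -> 'M[C]_(m, n)) (D : R -> 'M[C]_m).

Definition is_solution (x : R -> 'cV[C]_n) (u y : R -> 'cV[C]_m) : Prop :=
  [/\ Lp_loc 2%:E T u, Lp_loc 2%:E T y
    & exists dx, W11_loc T x dx /\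
      {ae mu, forall t, T t ->
         dx t = A t *m x t + B t *m u t /\ y t = C_ t *m x t + D t *m u t}].

Definition is_storage (V : R -> 'cV[C]_n -> R) : Prop :=
  [/\ forall t v, T t -> 0 <= V t v,
      forall t, T t -> V t 0 = 0
    & forall x u y, is_solution x u y ->
      forall t0 t1, T t0 -> T t1 -> t0 <= t1 ->
        V t1 (x t1) - V t0 (x t0) <=
        \int[mu]_(t in `[t0, t1]) complex.Re (((y t) ^t* *m u t) 0 0)].

(* v^H Q(t) v is real whenever Q(t) is Hermitian. *)
Definition VQ (Q : R -> 'M[C]_n) (t : R) (v : 'cV[C]_n) : R :=
  2^-1 * complex.Re ((v ^t* *m Q t *m v) 0 0).

Definition KYP_mx (Q : R -> 'M[C]_n) (t : R) : 'M[C]_(n + m) :=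
  block_mx (- ((A t) ^t* *m Q t) - Q t *m A t - mxderiv Q t)
           ((C_ t) ^t* - Q t *m B t)
           (C_ t - (B t) ^t* *m Q t)
           (D t + (D t) ^t*).

Definition KYP_solution (Q : R -> 'M[C]_n) : Prop :=
  {ae mu, forall t, T t -> mxderivable Q t /\ psdmx (KYP_mx Q t)}.

End systems.

(* Main.v *)
From HB Require Import structures.
Require Import Defs.
From mathcomp Require Import all_boot all_order all_algebra.
From mathcomp Require Import all_classical all_reals all_analysis.
From mathcomp Require Import measurable_realfun ess_sup_inf complex ring lra.

(** Along a state trajectory [x] the storage inequality says that
[integral of Re (y^H u) - V_Q (t, x t)] is nondecreasing; differentiating it at
a point where everything is differentiable gives exactly the quadratic form of
the KYP matrix at [(x t, u t)].  The trajectories of the augmented system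
[x' = A x + B u, u' = 0] span all values [(x t, u t)] and come from one
fundamental matrix, so countably many null sets suffice; almost everywhere
differentiability of [Q] is Lebesgue's theorem on monotone functions.

Conversely, absolute continuity is used only through the following fact: if
[f t - f s <= (w t - w s) (v t - v s)] for [s <= t], where [w] is continuous
and [w], [v] are nondecreasing, then [f] is nonincreasing.  Over [[s, t]] one
freezes [Q] at [s] and the endpoint values of [x]; the upper semicontinuity of
[Q] bounds the increment of [V_Q (t, x t)] by an integral whose integrand is,
by the KYP inequality at the current time, at most [Re (y^H u)] up to an error
of the above second-order form.  The same fact yields the product rule for
primitives, the convergence of Picard's iteration and the identification of
weak derivatives. *)

Set Implicit Arguments.
Unset Strict Implicit.
Unset Printing Implicit Defensive.

Import Order.TTheory GRing.Theory Num.Theory.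
Import numFieldNormedType.Exports.

Local Open Scope classical_set_scope.
Local Open Scope ring_scope.

(** * Primitives of locally integrable functions *)

(** The obstacle in the converse is that [Q] may jump or have a singular part, so [x^H Q x] need not
    be absolutely continuous and integrating its a.e. derivative does not recover its increments.
    Let [N] be a primitive of the a.e. derivative of [Q]; upper semicontinuity says that [N - Q]
    increases in the Loewner order. This is used twice: as a one-sided bound, by which the singular
    part of [Q] can only lower the storage, and, since the trace controls the norm of a positive
    semidefinite matrix, as a bound of the norm of [Q t - Q s] by increments of a real monotone
    function. That function may jump too, but every freezing error also carries an increment of a
    continuous function dominating the motion of [x]; hence the asymmetry between [w] and [v]. In
    the other direction the null set has to be fixed before the test vector. The trajectories are
    linear, and the supplied energy is quadratic, in a parameter vector [c], with matrix
    coefficients free of [c]. The exceptional times are those of the matrices, and [c] is chosen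
    after [t] by inverting the fundamental matrix. *)

Section comparison.
Context {R : realType}.
Implicit Types (f v w : R -> R) (a b : R).

(** Over a partition of [[a, b]] the increments of [f] add up to at most the largest increment of
    [w] times [v b - v a], and this vanishes with the mesh. In the application to storage functions,
    [v] jumps where [Q] does. *)
Lemma le_of_quadratic_increments f v w a b : a <= b ->
  {in `[a, b], continuous w} ->
  {in `[a, b] &, {homo w : x y / x <= y}} ->
  {in `[a, b] &, {homo v : x y / x <= y}} ->
  (forall s t, a <= s -> s <= t -> t <= b ->
    f t - f s <= (w t - w s) * (v t - v s)) ->
  f b <= f a.
Proof.
move=> ab cw wm vm H.
have vab : 0 <= v b - v a.
  by rewrite subr_ge0; apply: vm => //; rewrite in_itv/= lexx ab.
suff E e : 0 < e -> f b - f a <= e * (v b - v a).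
  rewrite -subr_le0; apply/ler_addgt0Pl => e e0; rewrite addr0.
  (* The [+ 1] keeps the denominator positive when [v a = v b]. *)
  have d0 : 0 < e / (v b - v a + 1) by rewrite divr_gt0// ltr_wpDl.
  apply: (le_trans (E _ d0)).
  by rewrite mulrAC ler_pdivrMr ?ltr_wpDl// ler_pM2l// lerDl.
move=> e0.
(* Continuity induction: the supremum [c] of [S] belongs to [S] because [w] moves by less than [e]
   just before [c], and if [c < b] the same bound just after [c] would extend [S] beyond its
   supremum. *)
pose S := [set t | a <= t <= b /\ f t - f a <= e * (v t - v a)].
have Sa : S a by rewrite /S/= lexx ab !subrr mulr0.
have supS : has_sup S by split; [exists a | exists b => t [/andP[]]].
have step s t : S s -> s <= t -> t <= b -> w t - w s <= e -> S t.
  move=> [/andP[as_ sb] fs] st tb wst; split; first by rewrite (le_trans as_).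
  have := H s t as_ st tb.
  have : v s <= v t.
    by apply: vm => //; rewrite in_itv/= ?as_ ?sb ?tb ?(le_trans as_ st).
  nra.
pose c := sup S.
have ac : a <= c by exact: ub_le_sup supS.2 _ Sa.
have cb : c <= b by apply: ge_sup; [exact: supS.1 | move=> t [/andP[]]].
have cab : c \in `[a, b] by rewrite in_itv/= ac cb.
have [d d0 wd] : exists2 d, 0 < d & forall t, a <= t <= b -> `|t - c| < d ->
    `|w t - w c| < e / 2.
  have /cvgrPdist_lt/(_ (e / 2)) := cw c cab.
  rewrite divr_gt0// => /(_ isT)[d /= d0 dw]; exists d => // t _ td.
  by rewrite distrC; apply: dw; rewrite /= distrC.
have [s Ss] := sup_adherent d0 supS; rewrite -/c => cs.
have sc : s <= c by exact: ub_le_sup supS.2 _ Ss.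
have [/andP[as_ sb] _] := Ss.
have Sc : S c.
  apply: (step s) => //.
  have : `|w s - w c| < e / 2 by apply: wd; rewrite ?as_ ?sb// ltr_distlC;
    apply/andP; split; lra.
  by rewrite ltr_distlC => /andP[]; lra.
have [bc|bc] := leP b c.
  by have [_] := Sc; have -> : c = b by apply/eqP; rewrite eq_le cb.
pose t := Num.min b (c + d / 2).
have ct : c < t by rewrite lt_min bc ltrDl divr_gt0.
have tb : t <= b by rewrite ge_min lexx.
have tcd : t <= c + d / 2 by rewrite ge_min lexx orbT.
have St : S t.
  apply: (step c) => //; first exact: ltW.
  have : `|w t - w c| < e / 2.
    by apply: wd; [rewrite tb andbT; lra | rewrite ltr_distlC; apply/andP; split; lra].
  by rewrite ltr_distlC => /andP[]; lra.
by have := ub_le_sup supS.2 St; rewrite leNgt ct.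
Qed.

End comparison.

Section primitives.
Context {R : realType}.
Local Notation mu := (@lebesgue_measure R).
Implicit Types (f g F G v w : R -> R) (a b c s t : R) (T : set R).

(* Unlike the library's [locally_integrable], this asks for no measurability on
   [T] itself. *)
Definition locint T f :=
  forall a b, `[a, b] `<=` T -> mu.-integrable `[a, b] (EFin \o f).

(** Local absolute continuity with a prescribed density. Stating it by increments over segments lets
    it serve both on the open interval and on a closed segment. *)
Definition prim T F f := locint T f /\
  forall a b, `[a, b] `<=` T -> a <= b ->
    F b - F a = \int[mu]_(t in `[a, b]) f t.

Lemma sub_segment T a b c d : `[a, b] `<=` T -> a <= c -> d <= b ->
  `[c, d] `<=` T.
Proof.
move=> abT ac db; apply: subset_trans abT => x /=; rewrite !in_itv/=.
by move=> /andP[cx xd]; rewrite (le_trans ac cx) (le_trans xd db).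
Qed.

Lemma segment_sub T s t : is_interval T -> T s -> T t -> `[s, t] `<=` T.
Proof. by move=> iT Ts Tt x /=; rewrite in_itv/= => sxt; exact: (iT s t). Qed.

Lemma open_segment T t : open T -> T t ->
  exists a b, [/\ a < t, t < b & `[a, b] `<=` T].
Proof.
move=> oT Tt; have [e /= e0 eT] := open_nbhs_nbhs (conj oT Tt).
exists (t - e / 2), (t + e / 2); split; [lra..|] => x /=.
rewrite in_itv/= => /andP[tx xt]; apply: eT => /=.
by rewrite ltr_distlC; apply/andP; split; lra.
Qed.

Lemma Rintegral_cat f a c b : mu.-integrable `[a, b] (EFin \o f) ->
  a <= c -> c <= b ->
  \int[mu]_(t in `[a, b]) f t =
  \int[mu]_(t in `[a, c]) f t + \int[mu]_(t in `[c, b]) f t.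
Proof.
move=> fab ac cb; apply/eqP; rewrite addrC -subr_eq; apply/eqP.
rewrite Rintegral_itvB//= ?Rintegral_itv_obnd_cbnd//.
by apply: integrableS fab => // x; apply: subset_itvr; rewrite bnd_simp.
Qed.

Lemma locintN T f : locint T f -> locint T (fun t => - f t).
Proof. by move=> fT a b abT; apply: integrableN (fT _ _ abT). Qed.

Lemma locintD T f g : locint T f -> locint T g -> locint T (fun t => f t + g t).
Proof. by move=> fT gT a b abT; apply: integrableD (fT _ _ abT) (gT _ _ abT). Qed.

Lemma locintB T f g : locint T f -> locint T g -> locint T (fun t => f t - g t).
Proof. by move=> fT /locintN; exact: locintD. Qed.

Lemma locintZ T c f : locint T f -> locint T (fun t => c * f t).
Proof. by move=> fT a b abT; apply: integrableZl (fT _ _ abT). Qed.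

Lemma locint_norm T f : locint T f -> locint T (fun t => `|f t|).
Proof. by move=> fT a b abT; apply: integrable_norm (fT _ _ abT). Qed.

Lemma locint_cst T c : locint T (fun=> c).
Proof.
move=> a b _; apply: continuous_compact_integrable.
  exact: segment_compact.
by apply: continuous_subspaceT => x; exact: cvg_cst.
Qed.

Lemma locint_sum T (I : Type) (r : seq I) (P : pred I) (h : I -> R -> R) :
  (forall i, P i -> locint T (h i)) ->
  locint T (fun t => \sum_(i <- r | P i) h i t).
Proof.
move=> hT; elim: r => [|i r IH].
  under eq_fun do rewrite big_nil; exact: locint_cst.
under eq_fun do rewrite big_cons.
by case: (boolP (P i)) => // Pi; apply: locintD => //; exact: hT.
Qed.

Lemma continuous_in_segment T f a b : {in T, continuous f} ->
  `[a, b] `<=` T -> {within `[a, b], continuous f}.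
Proof.
move=> cf abT; apply: continuous_in_subspaceT => x.
by rewrite inE => /abT Tx; apply: cf; rewrite inE.
Qed.

Lemma locintM T f g : {in T, continuous g} -> locint T f ->
  locint T (fun t => f t * g t).
Proof.
move=> cg fT a b abT.
have cg' := continuous_in_segment cg abT.
apply: integrableMl (fT _ _ abT) _ _ => //.
  exact: subspace_continuous_measurable_fun.
have : compact (g @` `[a, b]).
  by apply: continuous_compact => //; exact: segment_compact.
move/compact_bounded => [M [Mr MB]]; exists M; split => // x Mx t /= abt.
by apply: MB => //; exists t.
Qed.

Lemma continuous_locint T f : {in T, continuous f} -> locint T f.
Proof.
move=> cf; have := locintM cf (@locint_cst T 1).
by congr locint; apply/funext => t; rewrite mul1r.
Qed.

Lemma eq_prim T F f g : {in T, f =1 g} -> prim T F f -> prim T F g.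
Proof.
move=> fg [fT Ff]; split=> [a b abT|a b abT ab].
  apply: eq_integrable (fT _ _ abT) => //= x xab.
  by rewrite fg// inE; apply: abT; rewrite inE in xab.
rewrite Ff//; apply: eq_Rintegral => x xab.
by rewrite fg// inE; apply: abT; rewrite inE in xab.
Qed.

Lemma prim_cst T c : prim T (fun=> c) (fun=> 0).
Proof.
split; first exact: locint_cst.
by move=> a b _ _; rewrite subrr Rintegral_cst// mul0r.
Qed.

Lemma primD T F G f g : prim T F f -> prim T G g ->
  prim T (fun t => F t + G t) (fun t => f t + g t).
Proof.
move=> [fT Ff] [gT Gg]; split; first exact: locintD.
by move=> a b abT ab; rewrite RintegralD -?Ff -?Gg//; [ring|exact: fT|exact: gT].
Qed.

Lemma primN T F f : prim T F f -> prim T (fun t => - F t) (fun t => - f t).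
Proof.
move=> [fT Ff]; split; first exact: locintN.
move=> a b abT ab; under eq_Rintegral do rewrite -mulN1r.
by rewrite RintegralZl -?Ff//; [ring|exact: fT].
Qed.

Lemma primB T F G f g : prim T F f -> prim T G g ->
  prim T (fun t => F t - G t) (fun t => f t - g t).
Proof. by move=> Ff /primN; exact: primD. Qed.

Lemma primZ T c F f : prim T F f -> prim T (fun t => c * F t) (fun t => c * f t).
Proof.
move=> [fT Ff]; split; first exact: locintZ.
by move=> a b abT ab; rewrite -mulrBr Ff// RintegralZl//; exact: fT.
Qed.

Lemma prim_sum T (I : Type) (r : seq I) (F f : I -> R -> R) :
  (forall i, prim T (F i) (f i)) ->
  prim T (fun t => \sum_(i <- r) F i t) (fun t => \sum_(i <- r) f i t).
Proof.
move=> Ff; elim: r => [|i r IH].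
  under eq_fun do rewrite big_nil.
  under [X in prim _ _ X]eq_fun do rewrite big_nil.
  exact: prim_cst.
under eq_fun do rewrite big_cons.
under [X in prim _ _ X]eq_fun do rewrite big_cons.
exact: primD.
Qed.

Definition indef t0 f t := if t0 <= t then \int[mu]_(s in `[t0, t]) f s
  else - \int[mu]_(s in `[t, t0]) f s.

Lemma indefxx t0 f : indef t0 f t0 = 0.
Proof. by rewrite /indef lexx set_itv1 Rintegral_set1. Qed.

Lemma prim_indef T t0 f : is_interval T -> T t0 -> locint T f ->
  prim T (indef t0 f) f.
Proof.
move=> iT Tt0 fT; split=> // a b abT ab; rewrite /indef.
have Ta : T a by apply: abT; rewrite /= in_itv/= lexx.
have Tb : T b by apply: abT; rewrite /= in_itv/= lexx andbT.
have i1 := fT _ _ (segment_sub iT Tt0 Tb); have i2 := fT _ _ (segment_sub iT Ta Tt0).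
have [t0a|/ltW at0] := leP t0 a.
  by rewrite (le_trans t0a ab) (Rintegral_cat i1 t0a ab); ring.
have [t0b|/ltW bt0] := leP t0 b.
  by rewrite (Rintegral_cat (fT _ _ abT) at0 t0b); ring.
by rewrite (Rintegral_cat i2 ab bt0); ring.
Qed.

Lemma prim_ger0 T F f a b : prim T F f -> (forall t, T t -> 0 <= f t) ->
  `[a, b] `<=` T -> a <= b -> F a <= F b.
Proof.
move=> [fT Ff] f0 abT ab; rewrite -subr_ge0 Ff//.
by apply: Rintegral_ge0 => x /abT; exact: f0.
Qed.

Lemma prim_norm_le T F G f g a b : prim T F f -> prim T G g ->
  (forall t, T t -> `|f t| <= g t) ->
  `[a, b] `<=` T -> a <= b -> `|F b - F a| <= G b - G a.
Proof.
move=> [fT Ff] [gT Gg] fg abT ab; rewrite Ff// Gg//.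
apply: le_trans (le_normr_Rintegral _ (fT _ _ abT)) _ => //.
apply: le_Rintegral => //; last by move=> x /abT; exact: fg.
- exact: (locint_norm fT abT).
- exact: gT.
Qed.

Lemma prim_continuous T F f : open T -> prim T F f -> {in T, continuous F}.
Proof.
move=> oT [fT Ff] t; rewrite inE => Tt.
have [a [b [at_ tb abT]]] := open_segment oT Tt.
have ab : a < b by exact: lt_trans tb.
have tab : t \in `]a, b[ by rewrite in_itv/= at_ tb.
have := parameterized_integral_continuous (ltW ab) (fT _ _ abT).
move/(continuous_within_itvP _ ab) => [/(_ t tab) ct _ _].
have : {for t, continuous (fun x => F a + parameterized_integral mu a x f)}.
  by apply: cvgD => //; exact: cvg_cst.
rewrite /prop_for/continuous_at {2}/parameterized_integral -Ff ?ltW//; last first.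
  by apply: (sub_segment abT) => //; exact: ltW.
rewrite addrC subrK; apply: cvg_trans; apply: near_eq_cvg.
near=> x.
have xab : x \in `]a, b[ by near: x; exact: near_in_itvoo.
rewrite in_itv/= in xab; case/andP: xab => ax xb.
rewrite /parameterized_integral -Ff ?ltW//; last first.
  by apply: (sub_segment abT) => //; exact: ltW.
by rewrite addrC subrK.
Unshelve. all: by end_near. Qed.

(** The quantity bounded in the last hypothesis is the increment of [F - indef a f]. The comparison
    lemma, applied to this difference and to its opposite, shows that it takes the same value at [a]
    and [b]. *)
Lemma prim_of_quadratic T F f v w : is_interval T -> open T -> locint T f ->
  {in T, continuous w} ->
  {in T &, {homo w : x y / x <= y}} -> {in T &, {homo v : x y / x <= y}} ->
  (forall s t, `[s, t] `<=` T -> s <= t ->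
    `|F t - F s - \int[mu]_(r in `[s, t]) f r| <= (w t - w s) * (v t - v s)) ->
  prim T F f.
Proof.
move=> iT oT fT cw wm vm H; split=> // a b abT ab.
have Ta : T a by apply: abT; rewrite /= in_itv/= lexx.
have [_ If] := prim_indef iT Ta fT.
have inT x : x \in `[a, b] -> x \in T by move=> xab; rewrite inE; exact: abT.
pose D t := F t - indef a f t.
have HD s t : a <= s -> s <= t -> t <= b ->
    `|D t - D s| <= (w t - w s) * (v t - v s).
  move=> as_ st tb; have stT := sub_segment abT as_ tb.
  have -> : D t - D s = F t - F s - (indef a f t - indef a f s) by rewrite /D; ring.
  by rewrite If// H.
have cw' : {in `[a, b], continuous w} by move=> x /inT; exact: cw.
have wm' : {in `[a, b] &, {homo w : x y / x <= y}}.
  by move=> x y /inT xT /inT yT; exact: wm.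
have vm' : {in `[a, b] &, {homo v : x y / x <= y}}.
  by move=> x y /inT xT /inT yT; exact: vm.
have D1 : D b <= D a.
  apply: (le_of_quadratic_increments ab cw' wm' vm') => s t as_ st tb.
  exact: le_trans (ler_norm _) (HD _ _ as_ st tb).
have D2 : - D b <= - D a.
  apply: (le_of_quadratic_increments (f := fun t => - D t) ab cw' wm' vm').
  move=> s t as_ st tb; apply: le_trans (HD _ _ as_ st tb).
  by rewrite -opprD -normrN; exact: ler_norm.
have DE : D b = D a by apply/le_anti/andP; split => //; rewrite -lerN2.
have := If _ _ abT ab; move: DE; rewrite /D => + <-.
by move=> /eqP; rewrite subr_eq => /eqP ->; ring.
Qed.

(** Freezing [G] at the right end and [F] at the left end turns the increment of the product into an
    exact integral. What remains is the integral of [f r * (G t - G r) + (F s - F r) * g r], at most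
    the square of the increment of a primitive [W] of [|f| + |g|]; so [W] plays the part of both [w]
    and [v], and no double integral occurs. *)
Lemma primM T F G f g : is_interval T -> open T -> prim T F f -> prim T G g ->
  prim T (fun t => F t * G t) (fun t => f t * G t + F t * g t).
Proof.
move=> iT oT Ff Gg.
have cF := prim_continuous oT Ff; have cG := prim_continuous oT Gg.
have [fT FE] := Ff; have [gT GE] := Gg.
have [[t0 Tt0]|T0] := pselect (exists t, T t); last first.
  split=> [a b abT|a b abT ab]; last first.
    by exfalso; apply: T0; exists a; apply: abT; rewrite /= in_itv/= lexx.
  rewrite (_ : `[a, b]%classic = set0); first exact: integrable_set0.
  by apply/seteqP; split => // x /abT Tx; apply: T0; exists x.
have nT : locint T (fun t => `|f t| + `|g t|).
  by apply: locintD; exact: locint_norm.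
have Ww := prim_indef iT Tt0 nT; set W := indef _ _ in Ww.
have WE := Ww.2.
have mW : {in T &, {homo W : x y / x <= y}}.
  move=> x y; rewrite !inE => Tx Ty xy; apply: (prim_ger0 Ww) => //.
  exact: segment_sub.
apply: (prim_of_quadratic (w := W) (v := W)) => //.
- apply: locintD; first exact: locintM.
  by under eq_fun do rewrite mulrC; exact: locintM.
- exact: prim_continuous Ww.
move=> s t stT st.
have fst := fT _ _ stT; have gst := gT _ _ stT.
have fG : mu.-integrable `[s, t] (EFin \o (fun r => f r * G r)).
  exact: (locintM cG fT).
have Fg : mu.-integrable `[s, t] (EFin \o (fun r => F r * g r)).
  have := locintM cF gT stT; congr integrable; apply/funext => r /=.
  by rewrite mulrC.
have fGt : mu.-integrable `[s, t] (EFin \o (fun r => f r * G t)).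
  exact: integrableZr fst.
have Fsg : mu.-integrable `[s, t] (EFin \o (fun r => F s * g r)).
  exact: integrableZl gst.
have -> : F t * G t - F s * G s - \int[mu]_(r in `[s, t]) (f r * G r + F r * g r)
   = \int[mu]_(r in `[s, t]) (f r * (G t - G r) + (F s - F r) * g r).
  transitivity ((\int[mu]_(r in `[s, t]) (f r * G t + F s * g r)) -
      \int[mu]_(r in `[s, t]) (f r * G r + F r * g r)).
    congr (_ - _); rewrite RintegralD// RintegralZr// RintegralZl//.
    by rewrite -FE// -GE//; ring.
  rewrite -RintegralB//; first last.
  - exact: (integrableD _ fG Fg).
  - exact: (integrableD _ fGt Fsg).
  by apply: eq_Rintegral => r _; ring.
have Iw : mu.-integrable `[s, t]
    (EFin \o (fun r => (`|f r| + `|g r|) * (W t - W s))).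
  exact: integrableZr (nT _ _ stT).
have Ii : mu.-integrable `[s, t]
    (EFin \o (fun r => f r * (G t - G r) + (F s - F r) * g r)).
  have := integrableB _ (integrableD _ fGt Fsg) (integrableD _ fG Fg).
  move=> /(_ (measurable_itv _) (measurable_itv _) (measurable_itv _)).
  by congr integrable; apply/funext => r /=; congr EFin; ring.
apply: le_trans (le_normr_Rintegral _ Ii) _ => //.
rewrite {1}(WE _ _ stT st) -RintegralZr//; last exact: nT.
apply: le_Rintegral => //; first exact: integrable_norm Ii.
move=> r /=; rewrite in_itv/= => /andP[sr rt].
apply: le_trans (ler_normD _ _) _; rewrite !normrM mulrDl.
have srT := sub_segment stT (lexx s) rt; have rtT := sub_segment stT sr (lexx t).
have Tr : T r by apply: stT; rewrite /= in_itv/= sr rt.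
have Ts : T s by apply: stT; rewrite /= in_itv/= lexx st.
have Tt : T t by apply: stT; rewrite /= in_itv/= lexx st.
have WsWr : W s <= W r by apply: mW; rewrite ?inE.
have WrWt : W r <= W t by apply: mW; rewrite ?inE.
apply: lerD.
  apply: ler_wpM2l => //; apply: (@le_trans _ _ (W t - W r)); last by rewrite lerB.
  by apply: (prim_norm_le Gg Ww) => // x _; rewrite lerDr.
rewrite mulrC; apply: ler_wpM2l => //.
apply: (@le_trans _ _ (W r - W s)); last by rewrite lerB.
by rewrite distrC; apply: (prim_norm_le Ff Ww) => // x _; rewrite lerDl.
Qed.

End primitives.

(** * Almost everywhere statements and differentiation of primitives *)

Section almost_everywhere.
Context {R : realType}.
Local Notation mu := (@lebesgue_measure R).
Implicit Types (f g F G : R -> R) (a b c s t : R) (T : set R).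

Lemma ae_imply (P Q : R -> Prop) : (forall t, P t -> Q t) ->
  {ae mu, forall t, P t} -> {ae mu, forall t, Q t}.
Proof. by move=> PQ; apply: (@filterS _ _ (ae_filter_ringOfSetsType mu)). Qed.

Lemma ae_and (P Q : R -> Prop) : {ae mu, forall t, P t} ->
  {ae mu, forall t, Q t} -> {ae mu, forall t, P t /\ Q t}.
Proof. by move=> HP HQ; apply: (@filterI _ _ (ae_filter_ringOfSetsType mu)). Qed.

Lemma ae_fin (I : finType) (P : I -> R -> Prop) :
  (forall i, {ae mu, forall t, P i t}) -> {ae mu, forall t, forall i, P i t}.
Proof.
move=> HP; have : {ae mu, forall t, forall n : nat, oapp (P ^~ t) True (unpickle n)}.
  by apply: ae_foralln => n; case: (unpickle n) => [i|]; [exact: HP|exact: aeW].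
by apply: ae_imply => t Pt i; have := Pt (pickle i); rewrite pickleK.
Qed.

(** An open set is covered by the interiors of its segments with rational endpoints, so only
    countably many null sets are united. *)
Lemma ae_open T (P : R -> Prop) : open T ->
  (forall a b, `[a, b] `<=` T -> a < b ->
     {ae mu, forall t, a < t < b -> P t}) ->
  {ae mu, forall t, T t -> P t}.
Proof.
move=> oT TP.
pose S (pq : rat * rat) t := `[ratr pq.1, ratr pq.2] `<=` T ->
  ratr pq.1 < t < ratr pq.2 -> P t.
have : {ae mu, forall t, forall n, oapp (S ^~ t) True (unpickle n)}.
  apply: ae_foralln => n; case: (unpickle n) => [[p q]|]; last exact: aeW.
  rewrite /= /S /=.
  have [pqT|npqT] := pselect (`[ratr p, ratr q] `<=` T); last exact: aeW.
  have [pq|qp] := ltP (ratr p : R) (ratr q).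
    by apply: ae_imply (TP _ _ pqT pq) => t Pt _; exact: Pt.
  apply: aeW => t _ /= /andP[/lt_trans /[apply]].
  by rewrite ltNge qp.
apply: ae_imply => t St Tt.
have [a [b [at_ tb abT]]] := open_segment oT Tt.
have [p] := rat_in_itvoo at_; rewrite in_itv/= => /andP[ap pt].
have [q] := rat_in_itvoo tb; rewrite in_itv/= => /andP[tq qb].
have := St (pickle (p, q)); rewrite pickleK /= /S/= pt tq; apply => //.
by apply: (sub_segment abT); exact: ltW.
Qed.

(** Inside []a, b[] the function [F] is the constant [F a] plus the integral of the truncation of
    [f] to [[a, b]]. The truncation is integrable on the whole line, so Lebesgue differentiation
    applies to it. *)
Lemma prim_derive T F f : open T -> prim T F f ->
  {ae mu, forall t, T t -> is_derive t (1 : R) F (f t)}.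
Proof.
move=> oT [fT Ff]; apply: ae_open => // a b abT ab.
pose fab := f \_ `[a, b].
have ifab : mu.-integrable setT (EFin \o fab).
  by rewrite -restrict_EFin; apply: (integrable_mkcond _ _).1 => //; exact: fT.
have lfab : locally_integrable setT fab.
  by apply: open_integrable_locally => //; exact: openT.
have ify y : mu.-integrable `[a, y] (EFin \o fab).
  by apply: integrableS ifab.
have := FTC1 ify lfab.
apply: ae_imply => t + /andP[at_ tb].
move=> /(_ at_)[dI I'].
have tab : t \in `]a, b[ by rewrite in_itv/= at_ tb.
have := DeriveDef dI (esym (derive1E _ _)).
have tabc : `[a, b]%classic t by rewrite /= in_itv/= !ltW.
rewrite I' /fab patchE mem_set// => dF.
have {}dF : is_derive t (1 : R) (cst (F a) + (fun x => \int[mu]_(s in `[a, x]) fab s))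
    (f t).
  by rewrite -[f t]add0r; exact: is_deriveD.
apply: near_eq_is_derive dF.
near=> x.
have : x \in `]a, b[ by near: x; exact: near_in_itvoo.
rewrite in_itv/= => /andP[ax xb]; rewrite fctE/=.
have axT : `[a, x] `<=` T by apply: (sub_segment abT) => //; exact: ltW.
rewrite (_ : \int[mu]_(s in `[a, x]) fab s = F x - F a); first by rewrite addrC subrK.
rewrite Ff ?ltW//; apply: eq_Rintegral => s; rewrite inE/= in_itv/= => /andP[as_ sx].
by rewrite /fab patchE mem_set//= in_itv/= as_ (le_trans sx)// ltW.
Unshelve. all: by end_near. Qed.

Lemma prim_derive1 T F : (forall t, derivable F t 1) -> continuous (derive1 F) ->
  prim T F (derive1 F).
Proof.
move=> dF cF; split=> [|a b abT].
  by apply: continuous_locint => x _; exact: cF.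
rewrite le_eqVlt => /predU1P[->|ab].
  by rewrite set_itv1 Rintegral_set1 subrr.
have cont x : {for x, continuous F} by apply/differentiable_continuous/derivable1_diffP.
rewrite /Rintegral (@continuous_FTC2 _ _ F)//.
- by apply: continuous_subspaceT => x; exact: cF.
- split=> //; first by apply: cvg_at_right_filter; exact: cont.
  by apply: cvg_at_left_filter; exact: cont.
Qed.

End almost_everywhere.

(** * Lebesgue's theorem on monotone functions *)

Section lebesgue_monotone.
Context {R : realType}.
Local Notation mu := (@lebesgue_measure R).
Implicit Types (f g F G : R -> R) (a b c s t : R) (T : set R).

(** The Stieltjes measure is an infimum over countable covers by half-open intervals, and each such
    cover already bounds [m A]. Taking [m] as a bare set function allows it to be the length of a
    preimage as well as [mu] itself. *)
Lemma le_stieltjes_measure (h : cumulative R R) (m : set R -> \bar R) (A : set R) :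
  (forall F : nat -> set R, (forall k, measurable (F k)) ->
     A `<=` \bigcup_k F k -> (m A <= \sum_(k <oo) m (F k))%E) ->
  (forall B, 0 <= m B)%E -> m set0 = 0%E ->
  (forall c d, c < d -> (m `]c, d]%classic <= (h d - h c)%:E)%E) ->
  (m A <= lebesgue_stieltjes_measure h A)%E.
Proof.
move=> sub m0 ms0 itv; apply: le_ereal_inf_tmp => _ [F [mF AF] <-].
have mF' k : measurable (F k : set (measurableTypeR R)).
  exact: sub_sigma_algebra (mF k).
apply: le_trans (sub F mF' AF) _.
apply: lee_nneseries => // k _.
have /ocitvP[->|[[c d] /= cd ->]] := mF k; first by rewrite ms0; exact: wlength_ge0.
by rewrite wlength_itv_bnd ?(ltW cd)//; exact: itv.
Qed.

Lemma stieltjes_itv (h : cumulative R R) c d : c <= d ->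
  lebesgue_stieltjes_measure h `]c, d]%classic = (h d - h c)%:E.
Proof.
move=> cd; rewrite /lebesgue_stieltjes_measure /measure_extension.
by rewrite measurable_mu_extE/= ?wlength_itv_bnd//; exact: is_ocitv.
Qed.

Lemma measure_cover d (T : measurableType d) (m : {measure set T -> \bar R})
    (A : set T) (F : nat -> set T) : measurable A ->
  (forall k, measurable (F k)) -> A `<=` \bigcup_k F k ->
  (m A <= \sum_(k <oo) m (F k))%E.
Proof. by move=> mA mF AF; apply: measure_sigma_subadditive. Qed.

(** The Lipschitz bound makes the Stieltjes measure of [psi] dominated by Lebesgue measure and the
    bounds on [psi] make it finite, so Radon-Nikodym provides [p]. The last clause carries a
    comparison known on half-open intervals over to all measurable sets. *)
Lemma lipschitz_density (psi : R -> R) a b :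
  {homo psi : x y / x <= y} ->
  (forall x y, x <= y -> psi y - psi x <= y - x) ->
  (forall x, a <= psi x <= b) ->
  exists p : R -> R, [/\ mu.-integrable setT (EFin \o p),
    forall x y, x <= y -> psi y - psi x = \int[mu]_(t in `[x, y]) p t &
    forall (m : set R -> \bar R) (A : set R), measurable A ->
      (forall F : nat -> set R, (forall k, measurable (F k)) ->
        A `<=` \bigcup_k F k -> (m A <= \sum_(k <oo) m (F k))%E) ->
      (forall B, 0 <= m B)%E -> m set0 = 0%E ->
      (forall c d, c < d -> (m `]c, d]%classic <= (psi d - psi c)%:E)%E) ->
      (m A <= (\int[mu]_(t in A) (p t)%:E))%E].
Proof.
move=> mon lip bnd.
have rc : right_continuous psi.
  move=> x; apply/cvgrPdist_le => e e0; near=> y.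
  have xy : x < y by near: y; exact: nbhs_right_gt.
  rewrite distrC ger0_norm ?subr_ge0 ?mon ?(ltW xy)//.
  apply: le_trans (lip _ _ (ltW xy)) _; rewrite lerBlDl.
  by near: y; apply: nbhs_right_le; rewrite ltrDl.
pose h : cumulative R R := HB.pack psi (isCumulative.Build R _ R psi mon rc).
pose nu := lebesgue_stieltjes_measure h.
have nu_le A : measurable A -> (nu A <= mu A)%E.
  move=> mA; apply: le_stieltjes_measure => //.
  - by move=> F mF AF; exact: measure_cover.
  - by move=> c d cd; rewrite /nu stieltjes_itv ?(ltW cd)// lee_fin; exact/lip/ltW.
have nuT : (nu setT <= (b - a)%:E)%E.
  rewrite -(bigcup_itvT false false).
  pose I n : set R := `]- (n%:R), n%:R]%classic.
  have cvgI : (nu \o I) n @[n --> \oo] --> nu (\bigcup_n I n).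
    apply: nondecreasing_cvg_mu; rewrite /I//; first exact: bigcup_measurable.
    by move=> *; apply/subsetPset/subset_itv; rewrite leBSide/= ?lerN2 ler_nat.
  rewrite -(cvg_lim _ cvgI)//; apply: lime_le.
    by apply/cvg_ex; eexists; exact: cvgI.
  near=> n; rewrite /= /nu /I stieltjes_itv ?ge0_cp// lee_fin.
  by have /andP[_ +] := bnd n%:R; have /andP[+ _] := bnd (- n%:R); rewrite /h/=; lra.
have fin : fin_num_fun nu.
  move=> U mU; rewrite ge0_fin_numE ?measure_ge0//.
  apply: le_lt_trans (ltry (b - a)); apply: le_trans nuT.
  by apply: le_measure; rewrite ?inE.
pose nuf : {finite_measure set (measurableTypeR R) -> \bar R} :=
  HB.pack nu (Measure_isFinite.Build _ _ _ nu fin).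
pose ch := charge_of_finite_measure nuf.
have dom : ch `<< mu.
  apply/null_content_dominatesP => A mA muA; apply/eqP.
  by rewrite eq_le measure_ge0 andbT -muA nu_le.
have pfin x : Radon_Nikodym ch mu x \is a fin_num by exact: Radon_Nikodym_fin_num.
pose p x := fine (Radon_Nikodym ch mu x).
have pE : EFin \o p = Radon_Nikodym ch mu by apply/funext => x; rewrite /= fineK.
have nuE A : measurable A -> nu A = (\int[mu]_(t in A) (p t)%:E)%E.
  move=> mA; transitivity (\int[mu]_(t in A) Radon_Nikodym ch mu t)%E.
    exact: (Radon_Nikodym_integral dom mA).
  by apply: eq_integral => x _; rewrite -pE.
exists p; split.
- by rewrite pE; exact: Radon_Nikodym_integrable.
- move=> x y xy; have ip : mu.-integrable `]x, y] (EFin \o p).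
    rewrite pE; apply: (integrableS measurableT) => //.
    exact: Radon_Nikodym_integrable.
  rewrite -Rintegral_itv_obnd_cbnd// /Rintegral -nuE//.
  by rewrite /nu stieltjes_itv.
- move=> m A mA sub m0 ms0 itv; rewrite -nuE//.
  exact: le_stieltjes_measure.
Unshelve. all: by end_near. Qed.

(** In Caratheodory form, [psi y - psi (phi t) = g y * (y - phi t)] with [g] continuous and positive
    at [phi t]. Strict growth of [psi] across [phi t] traps [phi s] near [phi t], which gives
    continuity of [phi] at [t]; the difference quotients of [phi] are then [1 / g (phi z)] and
    converge to [1 / d]. *)
Lemma derivable_of_left_inverse (phi psi : R -> R) t d :
  {homo psi : x y / x <= y} -> (\near t, psi (phi t) = t) ->
  is_derive (phi t) (1 : R) psi d -> 0 < d -> derivable phi t 1.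
Proof.
move=> mon inv /is_derive1_caratheodory[g [gE cg gd]] d0.
have psit : psi (phi t) = t by exact: nbhs_singleton inv.
have gpos : \forall y \near phi t, 0 < g y.
  by have /cvgr_gt := cg; apply; rewrite gd.
have cphi : {for t, continuous phi}.
  apply/cvgrPdist_le => e e0.
  have [r /= r0 rg] := gpos.
  have m0 : 0 < Num.min e r by rewrite lt_min e0.
  have me : Num.min e r <= e by rewrite ge_min lexx.
  have mr : Num.min e r <= r by rewrite ge_min lexx orbT.
  pose k := Num.min e r / 2.
  have k0 : 0 < k by rewrite /k; lra.
  have g1 : 0 < g (phi t + k).
    by apply: rg; rewrite /ball_/= ltr_distlC; apply/andP; split; rewrite /k; lra.
  have g2 : 0 < g (phi t - k).
    by apply: rg; rewrite /ball_/= ltr_distlC; apply/andP; split; rewrite /k; lra.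
  have tk1 : t < psi (phi t + k) by have := gE (phi t + k); rewrite psit; nra.
  have tk2 : psi (phi t - k) < t by have := gE (phi t - k); rewrite psit; nra.
  near=> s.
  have sE : psi (phi s) = s by near: s; exact: inv.
  have s1 : s < psi (phi t + k) by near: s; exact: lt_nbhsl.
  have s2 : psi (phi t - k) < s by near: s; exact: lt_nbhsr.
  rewrite ler_distlC; apply/andP; split; rewrite leNgt; apply/negP => ps.
    have : psi (phi s) <= psi (phi t - k) by apply: mon; rewrite /k in ps *; lra.
    by rewrite sE leNgt s2.
  have : psi (phi t + k) <= psi (phi s) by apply: mon; rewrite /k in ps *; lra.
  by rewrite sE leNgt s1.
pose h z := if z == t then d^-1 else (phi z - phi t) / (z - t).
have : is_derive t (1 : R) phi (d^-1).
  apply/is_derive1_caratheodory; exists h; split; last by rewrite /h eqxx.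
    move=> z; rewrite /h; case: eqP => [->|/eqP zt]; first by rewrite !subrr mulr0.
    by rewrite mulfVK// subr_eq0.
  have cgphi : {for t, continuous (g \o phi)} by apply: continuous_comp.
  have cV : {for t, continuous (fun z => (g (phi z))^-1)}.
    by apply: continuousV => //=; rewrite gd gt_eqF.
  have hE : {near t, (fun z => (g (phi z))^-1) =1 h}.
    near=> z; rewrite /h; case: eqP => [->|/eqP zt]; first by rewrite gd.
    have gz : 0 < g (phi z) by near: z; exact: (cphi _ gpos).
    have := gE (phi z); rewrite psit.
    have -> : psi (phi z) = z by near: z; exact: inv.
    have [E|nz] := eqVneq (phi z - phi t) 0.
      by rewrite E mulr0 => /eqP; rewrite subr_eq0 (negbTE zt).
    by move=> ->; rewrite invfM mulrCA mulfV// mulr1.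
  rewrite /prop_for/continuous_at.
  rewrite {2}/h eqxx -gd; apply: cvg_trans cV.
  exact: near_eq_cvg.
by move=> H; exact: (@ex_derive _ _ _ _ _ _ _ H).
Unshelve. all: by end_near. Qed.

(* [phi = id + f] has a 1-Lipschitz left inverse [psi] on [[a, b]], and [psi' = p]
   almost everywhere for a Radon-Nikodym density [p].  Since
   [mu (phi^-1 A) <= int_A p], the points sent by [phi] into [{p <= 0}] or into
   the exceptional null set of [psi] form a null set; elsewhere [phi' = 1 / p]. *)
Lemma nondecreasing_ae_derivable (f : R -> R) a b : a < b ->
  {homo f : x y / x <= y} ->
  {ae mu, forall t, a < t < b -> derivable f t 1}.
Proof.
move=> ab fm.
pose phi t := t + f t.
(* Adding the identity gives [phi] slope at least 1, so [psi] is 1-Lipschitz even where [f] is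
   constant or jumps. *)
have phim s t : s <= t -> phi s + (t - s) <= phi t.
  by move=> /fm; rewrite /phi; lra.
(* Adjoining [a] keeps [S y] nonempty for [y] below [phi a], so that [psi] is defined on the whole
   line with values in [[a, b]]. *)
pose S y := [set t | t = a \/ a <= t <= b /\ phi t <= y].
pose psi y := sup (S y).
have Sa y : S y a by left.
have Sb y : has_ubound (S y) by exists b => t [->|[/andP[]//]]; exact: ltW.
have supS y : has_sup (S y) by split => //; exists a.
have le_psi y t : S y t -> t <= psi y by move=> St; exact: ub_le_sup.
have psi_le y t : (forall s, S y s -> s <= t) -> psi y <= t.
  by move=> St; apply: ge_sup => //; exists a.
have psim : {homo psi : x y / x <= y}.
  move=> x y xy; apply: psi_le => s Ss; apply: le_psi.
  by case: Ss => [->|[sab sx]]; [left|right; split => //; exact: le_trans xy].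
have psil x y : x <= y -> psi y - psi x <= y - x.
  move=> xy; rewrite lerBlDr; apply: psi_le => s [->|[/andP[as_ sb] sy]].
    by have := le_psi x a (Sa x); lra.
  have [l|l] := leP a (s - (y - x)); last by have := le_psi x a (Sa x); lra.
  have : s - (y - x) <= psi x; last lra.
  apply: le_psi; right; split; first by apply/andP; split; lra.
  by have := @phim (s - (y - x)) s; lra.
have psib x : a <= psi x <= b.
  apply/andP; split; first exact: le_psi.
  by apply: psi_le => s [->|[/andP[]//]]; exact: ltW.
have psiK t : a <= t <= b -> psi (phi t) = t.
  move=> tab; apply/eqP; rewrite eq_le; apply/andP; split; last first.
    by apply: le_psi; right.
  apply: psi_le => s [->|[_ st]]; first by case/andP: tab.
  by rewrite leNgt; apply/negP => ts; have := @phim t s (ltW ts); lra.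
have [p [ip pE pdom]] := lipschitz_density psim psil psib.
have Pp : prim setT psi p.
  split=> [x y _|x y _ xy]; last exact: pE.
  exact: integrableS ip.
have [N [mN N0 PN]] := prim_derive openT Pp.
have mp : measurable_fun setT p.
  by apply/measurable_EFinP; exact: measurable_int ip.
pose Z := [set y | p y <= 0].
have mZ : measurable Z.
  have := mp measurableT `]-oo, 0]%classic (measurable_itv _).
  by rewrite setTI; congr measurable; apply/seteqP; split => y; rewrite /= in_itv.
have mphi : measurable_fun setT phi.
  by apply: nondecreasing_measurable => // x y xy; have := phim x y xy; lra.
(* The part of [[a, b]] sent by [phi] into []c, d]] lies in [[psi c, psi d]], whose length is
   [psi d - psi c]. With countable subadditivity this is all that the density bound asks of [m]. *)
pose m A := mu (`[a, b] `&` phi @^-1` A).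
have mm A : measurable A -> measurable (`[a, b] `&` phi @^-1` A).
  by move=> mA; apply: measurableI => //; rewrite -[X in measurable X]setTI; exact: mphi.
have m_le A : measurable A -> (m A <= \int[mu]_(t in A) (p t)%:E)%E.
  move=> mA; apply: pdom => //.
  - move=> F mF AF; apply: measure_cover; [exact: mm|by move=> k; exact: mm|].
    by move=> t [tab /AF[k _ Fk]]; exists k.
  - by rewrite /m preimage_set0 setI0 measure0.
  - move=> c d cd.
    apply: (@le_trans _ _ (mu `[psi c, psi d]%classic)).
      apply: le_measure; rewrite ?inE//; first exact: mm.
      move=> t [/=]; rewrite !in_itv/= => tab /andP[ct td].
      by rewrite -(psiK t tab) !psim// ltW.
    rewrite lebesgue_measure_itv/= lte_fin; case: ifPn => // _.
    by rewrite lee_fin subr_ge0 psim// ltW.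
exists ((`[a, b] `&` phi @^-1` N) `|` (`[a, b] `&` phi @^-1` Z)); split.
- by apply: measurableU; exact: mm.
- apply/eqP; rewrite eq_le measure_ge0 andbT.
  apply: le_trans (measureU2 _ _ _) _; [exact: mm|exact: mm|].
  rewrite -[leRHS]adde0; apply: leeD.
    apply: le_trans (m_le _ mN) _; rewrite null_set_integral//.
    by apply/measurable_EFinP; exact: measurable_funTS.
  apply: le_trans (m_le _ mZ) _; rewrite -(integral0 mu Z).
  apply: le_integral => //; [exact: integrableS ip|exact: integrable0|].
  by move=> y; rewrite inE /Z/= lee_fin.
- move=> t /= /not_implyP[/andP[at_ tb] ndt].
  have tab : a <= t <= b by rewrite !ltW.
  have [pt|pt] := leP (p (phi t)) 0; first by right; split.
  left; split => //; apply: contrapT => nN; apply: ndt.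
  have dpsi : is_derive (phi t) (1 : R) psi (p (phi t)).
    by apply: contrapT => H; apply: nN; apply: PN => /= /(_ I).
  have : derivable phi t 1.
    apply: derivable_of_left_inverse dpsi pt => //.
    near=> s; apply: psiK; apply/andP; split; apply/ltW; near: s.
      exact: lt_nbhsr.
    exact: lt_nbhsl.
  have -> : f = phi - id by apply/funext => s; rewrite /phi !fctE addrC addKr.
  by move=> dphi; apply: derivableB => //; exact: derivable_id.
Unshelve. all: by end_near. Qed.

(** Jordan decomposition. The two variation functions are monotone on [[a, b]] only; composing them
    with the clamp [k] makes them monotone on the whole line without changing them near an interior
    point. *)
Lemma bounded_variation_ae_derivable (f : R -> R) a b : a < b ->
  bounded_variation a b f ->
  {ae mu, forall t, a < t < b -> derivable f t 1}.
Proof.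
move=> ab bvf.
pose k t := Num.max a (Num.min b t).
have kab t : k t \in `[a, b].
  by rewrite in_itv/= /k le_max lexx/= ge_max ltW//= ge_min lexx.
have km : {homo k : x y / x <= y}.
  move=> x y xy; rewrite /k ge_max le_max lexx/= le_max.
  by apply/orP; right; rewrite le_min ge_min lexx/= ge_min xy orbT.
have kE t : a < t < b -> k t = t.
  by move=> /andP[at_ tb]; rewrite /k min_r ?max_r// ltW.
have nm : {homo (fine \o neg_tv a f) \o k : x y / x <= y}.
  by move=> x y xy; apply: (fine_neg_tv_nondecreasing bvf) => //; exact: km.
have pm : {homo (fine \o pos_tv a f) \o k : x y / x <= y}.
  move=> x y xy; apply: (fine_neg_tv_nondecreasing (bounded_variationN bvf)) => //.
  exact: km.
have := ae_and (nondecreasing_ae_derivable ab nm) (nondecreasing_ae_derivable ab pm).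
apply: ae_imply => t [dn dp] tab.
have := derivableB (dp tab) (dn tab); apply: near_eq_derivable.
have : t \in `]a, b[ by rewrite in_itv.
move=> /near_in_itvoo; apply: filterS => s; rewrite in_itv/= => sab.
by rewrite (bounded_variation_pos_neg_tvE bvf) ?fctE/= ?kE// -(kE s sab).
Qed.

End lebesgue_monotone.

(** * Linear differential equations *)

Section geometric_convergence.
Context {R : realType}.

Lemma le_geometric_eq0 (x C : R) : (forall n : nat, `|x| <= C / 2 ^+ n) -> x = 0.
Proof.
move=> H; apply/eqP; rewrite -normr_le0; apply/ler_addgt0Pl => e e0; rewrite addr0.
have C0 : 0 <= C by have := H 0; rewrite expr0 divr1; exact: le_trans.
have [n Cn] : exists n : nat, C / e <= n%:R.
  by exists (Num.bound (C / e)); apply/ltW; apply: archi_boundP; rewrite divr_ge0// ?ltW.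
apply: le_trans (H n) _; rewrite ler_pdivrMr ?exprn_gt0//.
move: Cn; rewrite ler_pdivrMr// mulrC => /le_trans; apply.
by rewrite ler_pM2l// -natrX ler_nat ltnW// ltn_expl.
Qed.

Lemma geometric_cvg (u : R^nat) (C : R) :
  (forall n, `|u n.+1 - u n| <= C / 2 ^+ n) ->
  exists l : R, u @ \oo --> l /\ forall n, `|l - u n| <= 2 * C / 2 ^+ n.
Proof.
move=> H.
have C0 : 0 <= C by have := H 0; rewrite expr0 divr1; exact: le_trans.
(* Subtracting the remaining tail makes the bound stable under the induction on [m]. *)
have dist n m : `|u (n + m)%N - u n| <= 2 * C / 2 ^+ n - 2 * C / 2 ^+ (n + m)%N.
  elim: m => [|m IH]; first by rewrite addn0 !subrr normr0.
  rewrite addnS; apply: le_trans (ler_distD (u (n + m)%N) _ _) _.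
  apply: le_trans (lerD (H _) IH) _; rewrite exprS invfM.
  set x := (2 ^+ (n + m)%N)^-1; lra.
have dist' n m : (n <= m)%N -> `|u m - u n| <= 2 * C / 2 ^+ n.
  move=> nm; rewrite -(subnKC nm); apply: le_trans (dist _ _) _.
  by rewrite lerBlDr lerDl divr_ge0// ?exprn_ge0// mulr_ge0.
have cu : cvgn u.
  apply/cauchy_cvgP/cauchy_exP => e e0.
  have [N hN] : exists N : nat, 2 * C / 2 ^+ N < e.
    apply: contrapT => /forallNP H'; have : e = 0.
      apply: (@le_geometric_eq0 _ (2 * C)) => n.
      by rewrite gtr0_norm// leNgt; apply/negP; exact: H'.
    by move=> e00; rewrite e00 ltxx in e0.
  exists (u N); exists N => // m /= Nm; rewrite /ball/= distrC.
  exact: le_lt_trans (dist' _ _ Nm) hN.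
exists (limn u); split => // n; apply/ler_addgt0Pl => e e0.
have /cvgrPdist_le/(_ _ e0)[N _ hN] := cu.
have := hN (N + n)%N (leq_addr _ _); have := dist' n (N + n)%N (leq_addl _ _).
move=> H1 H2; apply: le_trans (ler_distD (u (N + n)%N) _ _) _; exact: lerD.
Qed.

End geometric_convergence.

Section linear_ode.
Context {R : realType}.
Local Notation mu := (@lebesgue_measure R).
Implicit Types (T : set R) (alpha w : R -> R).

Lemma expR_tangent (p q : R) : expR p * (q - p) <= expR q - expR p.
Proof.
have := expR_ge1Dx (q - p); rewrite -(ler_pM2l (expR_gt0 p)) -expRD.
by rewrite (_ : p + (q - p) = q); [lra|ring].
Qed.

Lemma prim_exists T t0 f : is_interval T -> T t0 -> locint T f ->
  exists2 F, prim T F f & F t0 = 0.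
Proof.
by move=> iT Tt0 fT; exists (indef t0 f); [exact: prim_indef|exact: indefxx].
Qed.

(* With [w' = alpha], the weight [E] satisfies [2 alpha E = S'], so one Picard
   step contracts by 1/2 in the [E]-weighted supremum norm on both sides of [t0]. *)
Lemma picard_weight T t0 alpha : open T -> is_interval T -> T t0 ->
  locint T alpha -> (forall t, 0 <= alpha t) ->
  exists E S : R -> R, [/\ {in T, continuous E}, forall t, 1 <= E t,
    forall t, `|S t| <= E t, S t0 = 0 &
    forall s t, `[s, t] `<=` T -> s <= t ->
      2 * \int[mu]_(r in `[s, t]) (alpha r * E r) <= S t - S s].
Proof.
move=> oT iT Tt0 alpha_int alpha_ge0.
have [w prim_w w0] := prim_exists iT Tt0 alpha_int.
have w_cont := prim_continuous oT prim_w.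
have w_mono s t : `[s, t] `<=` T -> s <= t -> w s <= w t.
  by apply: (prim_ger0 prim_w) => r _; exact: alpha_ge0.
(* The witnesses are [2 cosh (2 w)] and [2 sinh (2 w)]: the even one grows in both directions from
   [t0], the odd one vanishes at [t0] and is dominated by it. *)
exists (fun t => expR (2 * w t) + expR (- (2 * w t))).
exists (fun t => expR (2 * w t) - expR (- (2 * w t))).
have E_cont : {in T, continuous (fun t => expR (2 * w t) + expR (- (2 * w t)))}.
  move=> t Tt; have c2 : {for t, continuous (fun x => 2 * w x)}.
    by apply: continuousM; [exact: cvg_cst|exact: w_cont].
  have c3 : {for t, continuous (fun x => expR (2 * w x))}.
    by apply: continuous_comp => //; exact: continuous_expR.
  have c4 : {for t, continuous (fun x => expR (- (2 * w x)))}.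
    by apply: continuous_comp; [exact: continuousN|exact: continuous_expR].
  exact: continuousD c3 c4.
split=> //.
- move=> t; have [w1|w1] := leP 0 (2 * w t).
    have := expR_ge1Dx (2 * w t); have := expR_gt0 (- (2 * w t)); lra.
  have := expR_ge1Dx (- (2 * w t)); have := expR_gt0 (2 * w t); lra.
- move=> t; rewrite ler_norml.
  have := expR_gt0 (2 * w t); have := expR_gt0 (- (2 * w t)).
  by move=> H1 H2; apply/andP; split; lra.
- by rewrite w0 mulr0 oppr0 subrr.
move=> s t stT st.
have Ts : T s by apply: stT; rewrite /= in_itv/= lexx.
have E_int := locintM E_cont alpha_int.
have [P [_ IE] _] := prim_exists iT Ts E_int.
pose S t := expR (2 * w t) - expR (- (2 * w t)).
(* No chain rule for the exponential of [w] is invoked: tangent lines bound the growth of [S] from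
   below, and the increment of [2 P - S] is at most the product of the increments of [2 w] and
   [S]. *)
suff : 2 * P t - S t <= 2 * P s - S s.
  by rewrite -(IE _ _ stT st) -/(S t) -/(S s);
    move: (P t) (P s) (S t) (S s) => p q u v ?; lra.
apply: (@le_of_quadratic_increments _ (fun x => 2 * P x - S x) S
  (fun x => 2 * w x) s t st).
- move=> x xst; have := w_cont _ (mem_set (stT _ xst)).
  by move=> /(@continuousM _ _ (cst 2) w x (cvg_cst _)).
- move=> x y; rewrite !in_itv/= => /andP[sx xt] /andP[sy yt] xy.
  by rewrite ler_pM2l// w_mono//; exact: (sub_segment stT).
- move=> x y; rewrite !in_itv/= => /andP[sx xt] /andP[sy yt] xy.
  have wxy : w x <= w y by rewrite w_mono//; exact: (sub_segment stT).
  by rewrite /S; apply: lerB; rewrite ler_expR; lra.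
move=> x y sx xy yt; have xyT := sub_segment stT sx yt.
have wxy := w_mono _ _ xyT xy.
have : P y - P x <= (w y - w x) * (expR (2 * w y) + expR (- (2 * w x))).
  rewrite (IE _ _ xyT xy) (prim_w.2 _ _ xyT xy).
  rewrite -RintegralZr; [|exact: measurable_itv|exact: alpha_int].
  apply: le_Rintegral; [exact: measurable_itv|exact: E_int| |].
    exact: integrableZr (alpha_int _ _ xyT).
  move=> r; rewrite /= in_itv/= => /andP[xr ry]; apply: ler_wpM2l => //.
  have wxr : w x <= w r by rewrite w_mono//; exact: (sub_segment xyT).
  have wry : w r <= w y by rewrite w_mono//; exact: (sub_segment xyT).
  by apply: lerD; rewrite ler_expR; lra.
have := expR_tangent (2 * w x) (2 * w y).
have := expR_tangent (- (2 * w y)) (- (2 * w x)).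
rewrite /S; move: wxy; move: (w x) (w y) (P x) (P y) => p q P1 P2.
move: (expR (2 * p)) (expR (2 * q)) (expR (- (2 * p))) (expR (- (2 * q))).
move=> e1 e2 e3 e4 *; nra.
Qed.

Context (I : finType) (T : set R) (t0 : R) (a : I -> I -> R -> R) (c : I -> R).
Context (oT : open T) (iT : is_interval T) (Tt0 : T t0).
Context (a_int : forall i j, locint T (a i j)).
Context (alpha E S : R -> R).
Context (alpha_int : locint T alpha).
Context (a_alpha : forall i t, \sum_j `|a i j t| <= alpha t).
Context (E_cont : {in T, continuous E}) (E_ge1 : forall t, 1 <= E t).
Context (S_le_E : forall t, `|S t| <= E t) (S_t0 : S t0 = 0).
Context (int_alphaE : forall s t, `[s, t] `<=` T -> s <= t ->
  2 * \int[mu]_(r in `[s, t]) (alpha r * E r) <= S t - S s).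

Let alphaE_int : locint T (fun t => alpha t * E t).
Proof. exact: locintM. Qed.

(** Over a segment [F] moves by at most [M] times the integral of [alpha * E], that is, [M / 2]
    times the increment of [S]. As [S] vanishes at [t0] and is dominated by [E], going left or right
    from [t0] yields the same factor. *)
Let contraction (F f : R -> R) (M : R) : prim T F f -> F t0 = 0 -> 0 <= M ->
  (forall t, T t -> `|f t| <= M * (alpha t * E t)) ->
  forall t, T t -> `|F t| <= M / 2 * E t.
Proof.
move=> Ff F0 M0 fM t Tt.
have [P PE _] := prim_exists iT Tt0 (locintZ M alphaE_int).
have key x y : `[x, y] `<=` T -> x <= y -> `|F y - F x| <= M / 2 * (S y - S x).
  move=> xyT xy; apply: le_trans (prim_norm_le Ff PE fM xyT xy) _.
  rewrite PE.2// RintegralZl//; last exact: alphaE_int.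
  by have := int_alphaE xyT xy; nra.
have := S_le_E t; rewrite ler_norml => /andP[S1 S2].
have [t0t|/ltW tt0] := leP t0 t.
  have := key _ _ (segment_sub iT Tt0 Tt) t0t; rewrite F0 subr0 S_t0 subr0.
  by move=> /le_trans; apply; rewrite ler_wpM2l// divr_ge0.
have := key _ _ (segment_sub iT Tt Tt0) tt0; rewrite F0 sub0r S_t0 sub0r normrN.
by move=> /le_trans; apply; rewrite ler_wpM2l// ?divr_ge0//; lra.
Qed.

Let sum_le_alpha i (f : I -> R) (K t : R) : (forall j, `|f j| <= K) ->
  `|\sum_j a i j t * f j| <= alpha t * K.
Proof.
move=> fK; have K0 : 0 <= K by exact: le_trans (fK i).
apply: le_trans (ler_norm_sum _ _ _) _; apply: le_trans (ler_wpM2r K0 (a_alpha i t)).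
rewrite mulr_suml; apply: ler_sum => j _; rewrite normrM.
exact: ler_wpM2l.
Qed.

(** Starting from zero makes the first difference the constant [c i], which is at most [K * E t]
    because [1 <= E t]. *)
Fixpoint picard (k : nat) (i : I) : R -> R :=
  if k is k'.+1 then
    fun t => c i + indef t0 (fun r => \sum_j a i j r * picard k' j r) t
  else fun=> 0.

Let picard_cont k i : {in T, continuous (picard k i)}.
Proof.
elim: k i => [|k IH] i t Tt; first exact: cvg_cst.
apply: continuousD; first exact: cvg_cst.
apply: (prim_continuous oT (prim_indef iT Tt0 _)) => //.
by apply: locint_sum => j _; exact: locintM.
Qed.

Let picard_prim k i :
  prim T (picard k.+1 i) (fun t => \sum_j a i j t * picard k j t).
Proof.
have /= := primD (prim_cst T (c i)) (prim_indef iT Tt0 (f :=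
  fun r => \sum_j a i j r * picard k j r) _).
under [X in prim _ _ X]eq_fun do rewrite add0r.
by apply; apply: locint_sum => j _; exact: locintM.
Qed.

Let K := \sum_i `|c i|.

Let picard_diff k i t : T t ->
  `|picard k.+1 i t - picard k i t| <= K * E t / 2 ^+ k.
Proof.
have K0 : 0 <= K by exact: sumr_ge0.
elim: k i t => [|k IH] i t Tt.
  rewrite [picard 1 i t]/= (_ : (fun r => _) = fun=> 0); last first.
    by apply/funext => r; rewrite big1// => j _; rewrite mulr0.
  rewrite (_ : indef _ _ _ = 0); last first.
    by rewrite /indef !Rintegral_cst// !mul0r oppr0 if_same.
  rewrite addr0 subr0 expr0 divr1; apply: (@le_trans _ _ K).
    by rewrite /K (bigD1 i)//= lerDl sumr_ge0.
  by have := E_ge1 t; nra.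
have D := primB (picard_prim k.+1 i) (picard_prim k i).
have D0 : picard k.+2 i t0 - picard k.+1 i t0 = 0 by rewrite /= !indefxx subrr.
have M0 : 0 <= K / 2 ^+ k by rewrite divr_ge0// exprn_ge0.
have /(_ _ t Tt) := contraction D D0 M0.
rewrite exprS invfM.
have -> : K / 2 ^+ k / 2 * E t = K * E t * (2^-1 * (2 ^+ k)^-1) by ring.
apply=> r Tr; rewrite -sumrB; under eq_bigr do rewrite -mulrBr.
rewrite mulrCA; apply: sum_le_alpha => j.
by rewrite mulrAC; exact: IH.
Qed.

Lemma linear_ode_weighted : exists z : I -> R -> R,
  (forall i, prim T (z i) (fun t => \sum_j a i j t * z j t)) /\
  (forall i, z i t0 = c i).
Proof.
have K0 : 0 <= K by exact: sumr_ge0.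
have /choice[z zP] (i : I) : exists z : R -> R, forall t, T t ->
    (picard ^~ i ^~ t @ \oo --> z t) /\
    forall k, `|z t - picard k i t| <= 2 * (K * E t) / 2 ^+ k.
  have /choice[z zP] (t : R) : exists l : R, T t ->
      (picard ^~ i ^~ t @ \oo --> l) /\
      forall k, `|l - picard k i t| <= 2 * (K * E t) / 2 ^+ k.
    have [Tt|nT] := pselect (T t); last by exists 0.
    have [l Hl] := geometric_cvg (fun k => picard_diff k i Tt).
    by exists l.
  by exists z.
have zc i t : T t -> picard ^~ i ^~ t @ \oo --> z i t by move=> /(zP i)[].
have zd i k t : T t -> `|z i t - picard k i t| <= 2 * (K * E t) / 2 ^+ k.
  by move=> /(zP i)[].
(* The limit [z j] is measurable as a pointwise limit of continuous functions, and its distance to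
   the zeroth iterate, which is zero, provides the majorant [2 * (K * E t)]. *)
have az_int i j : locint T (fun t => a i j t * z j t).
  move=> p q pqT.
  have mz : measurable_fun `[p, q] (z j).
    apply: (@measurable_fun_cvg _ _ _ _ (picard ^~ j)) => [k|x /pqT]; last exact: zc.
    apply: subspace_continuous_measurable_fun => //.
    exact: (continuous_in_segment (@picard_cont k j)).
  have ma := measurable_int _ (a_int i j pqT).
  have := locintZ (2 * K) (locintM E_cont (locint_norm (a_int i j))) pqT.
  apply: le_integrable => //.
    by apply/measurable_EFinP/measurable_funM => //; exact/measurable_EFinP.
  move=> x /pqT Tx /=; rewrite lee_fin normrM [leRHS]ger0_norm; last first.
    have := E_ge1 x => E1; rewrite mulr_ge0// ?mulr_ge0//; lra.
  rewrite mulrCA; apply: ler_wpM2l => //.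
  by have := zd j 0 x Tx; rewrite /= subr0 expr0 divr1 mulrA.
exists z; split=> i; last first.
  apply/eqP; rewrite -subr_eq0; apply/eqP.
  apply: (@le_geometric_eq0 _ _ (2 * (K * E t0))) => k.
  (* The index is shifted because the zeroth iterate does not take the initial value [c i]. *)
  have := zd i k.+1 t0 Tt0; rewrite /= indefxx addr0 => /le_trans; apply.
  rewrite exprS invfM mulrCA ler_piMl// ?divr_ge0 ?exprn_ge0 ?mulr_ge0//; last lra.
  by have := E_ge1 t0; lra.
split=> [|p q pqT pq]; first by apply: locint_sum => j _; exact: az_int.
apply/eqP; rewrite -subr_eq0; apply/eqP.
(* The three terms account for replacing [z] by an iterate at [q], at [p] and under the integral.
   Each error is geometric in [k], so the integral equation passes to the limit through the weighted
   estimate. *)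
pose C := 2 * (K * E q) + 2 * (K * E p) + K * (S q - S p).
apply: (@le_geometric_eq0 _ _ C) => k.
have pT : T p by apply: pqT; rewrite /= in_itv/= lexx.
have qT : T q by apply: pqT; rewrite /= in_itv/= lexx andbT.
have iz : locint T (fun t => \sum_j a i j t * z j t).
  by apply: locint_sum => j _; exact: az_int.
have [ik ikE] := picard_prim k i.
have zk x : T x -> `|z i x - picard k.+1 i x| <= 2 * (K * E x) / 2 ^+ k.
  move=> Tx; apply: le_trans (zd i k.+1 x Tx) _.
  rewrite exprS invfM mulrCA ler_piMl// ?divr_ge0 ?exprn_ge0 ?mulr_ge0//; last lra.
  by have := E_ge1 x; lra.
have -> : z i q - z i p - \int[mu]_(t in `[p, q]) \sum_j a i j t * z j t =
    (z i q - picard k.+1 i q) + (picard k.+1 i p - z i p) +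
    \int[mu]_(t in `[p, q]) \sum_j a i j t * (picard k j t - z j t).
  have -> : \int[mu]_(t in `[p, q]) \sum_j a i j t * (picard k j t - z j t) =
      \int[mu]_(t in `[p, q]) \sum_j a i j t * picard k j t -
      \int[mu]_(t in `[p, q]) \sum_j a i j t * z j t.
    rewrite -RintegralB//; [|exact: ik|exact: iz].
    apply: eq_Rintegral => x _; rewrite -sumrB; apply: eq_bigr => j _.
    by rewrite mulrBr.
  by rewrite -ikE//; ring.
have -> : C / 2 ^+ k = 2 * (K * E q) / 2 ^+ k + 2 * (K * E p) / 2 ^+ k +
    K / 2 ^+ k * (S q - S p) by rewrite /C; ring.
apply: le_trans (ler_normD _ _) _; apply: lerD.
  apply: le_trans (ler_normD _ _) _; apply: lerD; first exact: zk.
  by rewrite distrC; exact: zk.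
have id : mu.-integrable `[p, q]
    (EFin \o (fun t => \sum_j a i j t * (picard k j t - z j t))).
  have := locintB ik iz pqT; congr integrable; apply/funext => x /=; congr EFin.
  by rewrite -sumrB; apply: eq_bigr => j _; rewrite mulrBr.
apply: le_trans (le_normr_Rintegral _ id) _ => //.
have K2 : 0 <= K / 2 ^+ k by rewrite divr_ge0// exprn_ge0.
apply: (@le_trans _ _ (\int[mu]_(t in `[p, q]) (2 * K / 2 ^+ k * (alpha t * E t)))).
  apply: le_Rintegral => //; first exact: integrable_norm id.
    exact: (locintZ _ alphaE_int).
  move=> x /pqT Tx; rewrite mulrCA; apply: sum_le_alpha => j.
  rewrite distrC; apply: le_trans (zd j k x Tx) _.
  by rewrite le_eqVlt; apply/orP; left; apply/eqP; ring.
rewrite RintegralZl//; last exact: alphaE_int.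
have := int_alphaE pqT pq.
rewrite (_ : 2 * K / 2 ^+ k = K / 2 ^+ k * 2); last by ring.
by move=> /(ler_wpM2l K2); rewrite mulrA.
Qed.

End linear_ode.

Lemma linear_ode (R : realType) (I : finType) (T : set R) (t0 : R)
    (a : I -> I -> R -> R) (c : I -> R) :
  open T -> is_interval T -> T t0 -> (forall i j, locint T (a i j)) ->
  exists z : I -> R -> R,
  (forall i, prim T (z i) (fun t => \sum_j a i j t * z j t)) /\
  (forall i, z i t0 = c i).
Proof.
move=> oT iT Tt0 a_int.
have alpha_int : locint T (fun t => \sum_i \sum_j `|a i j t|).
  by apply: locint_sum => i _; apply: locint_sum => j _; exact: locint_norm.
have alpha_ge0 t : 0 <= \sum_i \sum_j `|a i j t|.
  by apply: sumr_ge0 => i _; exact: sumr_ge0.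
have [E [S [E_cont E_ge1 S_le_E S_t0 int_alphaE]]] :=
  picard_weight oT iT Tt0 alpha_int alpha_ge0.
apply: (linear_ode_weighted _ oT iT Tt0 a_int alpha_int _ E_cont E_ge1 S_le_E
  S_t0 int_alphaE) => i t.
rewrite [leRHS](bigD1 i)//= lerDl.
by apply: sumr_ge0 => k _; exact: sumr_ge0.
Qed.

(** * Weak derivatives *)

Section weak_derivatives.
Context {R : realType}.
Local Notation mu := (@lebesgue_measure R).
Implicit Types (f g F G phi : R -> R) (a b c d s t : R) (T : set R).

Lemma Rintegral_support T g a b : `[a, b] `<=` T ->
  (forall t, ~~ (a <= t <= b) -> g t = 0) ->
  \int[mu]_(t in T) g t = \int[mu]_(t in `[a, b]) g t.
Proof.
move=> abT g0; rewrite Rintegral_mkcond [RHS]Rintegral_mkcond.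
apply: eq_Rintegral => t _; rewrite !patchE.
have [tab|tab] := boolP (a <= t <= b).
  by rewrite !mem_set//; apply: abT.
by rewrite (g0 t)// !if_same.
Qed.

(** Openness of [T] leaves room to widen the support segment, so that boundary terms vanish in
    integrations by parts. A support given with [b < a] means that [phi] is zero, and then any
    nondegenerate segment of [T] serves. *)
Lemma test_function_segment T phi : open T -> T !=set0 -> test_function T phi ->
  exists a b, [/\ a < b, `[a, b] `<=` T, phi a = 0, phi b = 0 &
    forall t, ~~ (a <= t <= b) -> phi t = 0 /\ derive1 phi t = 0].
Proof.
move=> oT [t0 Tt0] [dphi cphi [a [b [abT phi0]]]].
have dphi0 t : ~~ (a <= t <= b) -> derive1 phi t = 0.
  move=> tab; have : \forall x \near t, cst 0 x = phi x.
    move: tab; rewrite negb_and -!ltNge => /orP[ta|bt].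
      near=> x; rewrite phi0// negb_and -!ltNge; apply/orP; left.
      by near: x; exact: lt_nbhsl.
    near=> x; rewrite phi0// negb_and -!ltNge; apply/orP; right.
    by near: x; exact: lt_nbhsr.
  by move=> /near_eq_derive E; rewrite derive1E -E derive_cst.
have [ab|ba] := leP a b; last first.
  have {}phi0 t : phi t = 0.
    by apply: phi0; apply/negP => /andP[at_ tb]; have := le_trans at_ tb; lra.
  have {}dphi0 t : derive1 phi t = 0.
    by apply: dphi0; apply/negP => /andP[at_ tb]; have := le_trans at_ tb; lra.
  have [a' [b' [a't tb' abT']]] := open_segment oT Tt0.
  by exists a', b'; split => //; exact: lt_trans tb'.
have Ta : T a by apply: abT; rewrite /= in_itv/= lexx.
have Tb : T b by apply: abT; rewrite /= in_itv/= lexx andbT.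
have [a' [a'' [a'a aa'' aT']]] := open_segment oT Ta.
have [b'' [b' [b''b bb' bT']]] := open_segment oT Tb.
exists a', b'; split.
- lra.
- move=> x; rewrite /= in_itv/= => /andP[a'x xb'].
  have [xa|ax] := ltP x a.
    by apply: aT'; rewrite /= in_itv/= a'x; lra.
  have [bx|xb] := ltP b x; last by apply: abT; rewrite /= in_itv/= ax.
  by apply: bT'; rewrite /= in_itv/= xb' andbT; lra.
- by apply: phi0; rewrite negb_and -!ltNge a'a.
- by apply: phi0; rewrite negb_and -!ltNge bb' orbT.
- move=> t tab; suff H : ~~ (a <= t <= b) by rewrite phi0// dphi0.
  by apply: contra tab => /andP[at_ tb]; apply/andP; split; lra.
Unshelve. all: by end_near. Qed.

(** Integration by parts: the product rule for [F * phi] over a segment at whose ends [phi]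
    vanishes. *)
Lemma prim_weak_derivative T F f : open T -> is_interval T -> prim T F f ->
  weak_derivative T F f.
Proof.
move=> oT iT Ff phi tphi.
have [[t Tt]|T0] := pselect (T !=set0); last first.
  have -> : T = set0 by apply/seteqP; split => // t Tt; apply: T0; exists t.
  by rewrite !Rintegral_set0 oppr0.
have [a [b [ab abT pa pb p0]]] := test_function_segment oT (ex_intro _ t Tt) tphi.
have [dphi cphi _] := tphi.
have Pphi : prim T phi (derive1 phi) := prim_derive1 _ dphi cphi.
have := (primM iT oT Ff Pphi).2 _ _ abT (ltW ab).
have cF := prim_continuous oT Ff.
have ctphi := prim_continuous oT Pphi.
have cdphi : {in T, continuous (derive1 phi)} by move=> x _; exact: cphi.
rewrite pa pb !mulr0 subrr RintegralD//; last 2 first.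
- exact: (locintM ctphi Ff.1).
- have := locintM cF (continuous_locint cdphi) abT.
  by congr integrable; apply/funext => x /=; rewrite mulrC.
rewrite (Rintegral_support (g := fun t => F t * derive1 phi t) abT); last first.
  by move=> x /p0[_ ->]; rewrite mulr0.
rewrite (Rintegral_support (g := fun t => f t * phi t) abT); last first.
  by move=> x /p0[-> _]; rewrite mulr0.
lra.
Qed.

Let pp c x : R := Num.max (x - c) 0.

Let pp_cont c : continuous (pp c).
Proof.
move=> x; apply: (@continuous_max _ R (fun x => x - c) (fun=> 0)).
  by apply: continuousB; [exact: cvg_id|exact: cvg_cst].
exact: cvg_cst.
Qed.

(** The first-order remainder of a squared positive part is at most [(y - x) ^+ 2]. Second
    differences of such squares in [c] are the building blocks of the test functions. *)
Let pp_derive c x : is_derive x (1 : R) (fun y => pp c y ^+ 2) (2 * pp c x).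
Proof.
have key y : `|pp c y ^+ 2 - pp c x ^+ 2 - 2 * pp c x * (y - x)| <= (y - x) ^+ 2.
  rewrite (_ : y - x = (y - c) - (x - c)); last by ring.
  rewrite ler_norml /pp; move: (y - c) (x - c) => v u.
  have := sqr_ge0 v; have := sqr_ge0 u; have := sqr_ge0 (v - u).
  by case: (leP v 0) => v0; case: (leP u 0) => u0 *; apply/andP; split; nra.
apply/is_derive1_caratheodory.
exists (fun y => if y == x then 2 * pp c x
                 else (pp c y ^+ 2 - pp c x ^+ 2) / (y - x)); split.
- move=> y; case: eqP => [->|/eqP yx]; first by rewrite !subrr mulr0.
  by rewrite mulfVK// subr_eq0.
- apply/cvgrPdist_le => e e0; near=> y; rewrite eqxx; case: eqP => [_|/eqP yx].
    by rewrite subrr normr0; exact: ltW.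
  have yxe : `|y - x| <= e.
    by near: y; exists e => //= y; rewrite /ball_/= distrC => /ltW.
  apply: le_trans yxe; have yx0 : y - x != 0 by rewrite subr_eq0.
  rewrite distrC -(ler_pM2r (x := `|y - x|)) ?normr_gt0// -normrM mulrBl mulfVK//.
  by rewrite -expr2 real_normK ?num_real.
- by rewrite eqxx.
Unshelve. all: by end_near. Qed.

(* The C^1 quadratic spline rising from 0 to 1 over [[c, c + 2 d]], and its
   derivative. *)
Let bump d c x : R :=
  (pp c x ^+ 2 - 2 * pp (c + d) x ^+ 2 + pp (c + 2 * d) x ^+ 2) / (2 * d ^+ 2).
Let hat d c x : R := (pp c x - 2 * pp (c + d) x + pp (c + 2 * d) x) / d ^+ 2.

Let bump_derive d c x : 0 < d -> is_derive x (1 : R) (bump d c) (hat d c x).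
Proof.
move=> d0.
have D1 := pp_derive c x; have D2 := pp_derive (c + d) x.
have D3 := pp_derive (c + 2 * d) x.
have -> : bump d c = (2 * d ^+ 2)^-1 \*: ((fun y => pp c y ^+ 2) -
    2 \*: (fun y => pp (c + d) y ^+ 2) + (fun y => pp (c + 2 * d) y ^+ 2)).
  apply/funext => y; rewrite /bump !fctE mulrC.
  by rewrite /GRing.scale/=.
have -> : hat d c x = (2 * d ^+ 2)^-1 *: (2 * pp c x -
    2 *: (2 * pp (c + d) x) + 2 * pp (c + 2 * d) x).
  rewrite /hat /GRing.scale/=; field; lra.
exact: is_deriveZ.
Qed.

Let bump_derive1 d c : 0 < d -> derive1 (bump d c) = hat d c.
Proof.
move=> d0; apply/funext => x; rewrite derive1E; have H := bump_derive c x d0.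
exact: derive_val.
Qed.

Let hat_cont d c : continuous (hat d c).
Proof.
move=> x; have c1 := @pp_cont c x; have c2 := @pp_cont (c + d) x.
have c3 := @pp_cont (c + 2 * d) x.
have c4 : {for x, continuous (fun x => pp c x - 2 * pp (c + d) x)}.
  by apply: continuousB => //; apply: continuousM => //; exact: cvg_cst.
have c5 : {for x, continuous
    (fun x => pp c x - 2 * pp (c + d) x + pp (c + 2 * d) x)}.
  exact: continuousD c4 c3.
have : {for x, continuous
    (fun x => (d ^+ 2)^-1 * (pp c x - 2 * pp (c + d) x + pp (c + 2 * d) x))}.
  by apply: continuousM => //; exact: cvg_cst.
by under [X in {for x, continuous X}]eq_fun do rewrite mulrC.
Qed.

Let bump_l d c x : 0 < d -> x <= c -> bump d c x = 0.
Proof.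
move=> d0 xc; rewrite /bump /pp !max_r; first by rewrite expr0n/=; ring.
all: lra.
Qed.

Let bump_r d c x : 0 < d -> c + 2 * d <= x -> bump d c x = 1.
Proof.
move=> d0 xc; rewrite /bump /pp !max_l; first by field; lra.
all: lra.
Qed.

Let hat_ge0 d c x : 0 < d -> 0 <= hat d c x.
Proof.
move=> d0; rewrite /hat divr_ge0 ?exprn_even_ge0// /pp.
by case: (leP (x - c) 0) => ?; case: (leP (x - (c + d)) 0) => ?;
  case: (leP (x - (c + 2 * d)) 0) => ?; lra.
Qed.

Let hat_eq0 d c x : 0 < d -> ~~ (c <= x <= c + 2 * d) -> hat d c x = 0.
Proof.
move=> d0; rewrite negb_and -!ltNge => /orP[xc|xc].
  by rewrite /hat /pp !max_r; [rewrite !mulr0 subrr addr0 mul0r|lra..].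
by rewrite /hat /pp !max_l; [rewrite (_ : _ - _ + _ = 0) ?mul0r//; ring|lra..].
Qed.

(** [hat d c] is a nonnegative kernel supported in [[c, c + 2 * d]], of mass 1 since that is the
    total rise of [bump d c]; the integral is thus an average of [h] just to the right of [c]. *)
Let hat_average T (h : R -> R) a b c d e : 0 < d -> `[a, b] `<=` T ->
  {in T, continuous h} -> a <= c -> c + 2 * d <= b ->
  (forall x, c <= x <= c + 2 * d -> `|h x - h c| <= e) ->
  `|\int[mu]_(x in `[a, b]) (h x * hat d c x) - h c| <= e.
Proof.
move=> d0 abT ch ac cb he.
have dbump t : derivable (bump d c) t 1.
  exact: (@ex_derive _ _ _ _ _ _ _ (bump_derive c t d0)).
have cbump : continuous (derive1 (bump d c)).
  by rewrite bump_derive1//; exact: hat_cont.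
have Pb : prim T (bump d c) (hat d c).
  by have := prim_derive1 T dbump cbump; rewrite bump_derive1.
have ab : a <= b by lra.
have I1 : \int[mu]_(x in `[a, b]) hat d c x = 1.
  by rewrite -(Pb.2 _ _ abT ab) bump_r// bump_l// subr0.
have ihat := Pb.1 _ _ abT.
have ihh : mu.-integrable `[a, b] (EFin \o (fun x => h x * hat d c x)).
  have := locintM ch Pb.1 abT; congr integrable; apply/funext => x /=.
  by rewrite mulrC.
have ihc : mu.-integrable `[a, b] (EFin \o (fun x => h c * hat d c x)).
  exact: (locintZ (h c) Pb.1 abT).
have -> : \int[mu]_(x in `[a, b]) (h x * hat d c x) - h c =
    \int[mu]_(x in `[a, b]) (h x * hat d c x - h c * hat d c x).
  by rewrite RintegralB// RintegralZl// I1 mulr1.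
have ihd := integrableB _ ihh ihc.
apply: le_trans (le_normr_Rintegral _ _) _ => //; first exact: ihd.
rewrite -[leRHS]mulr1 -I1 -RintegralZl//.
apply: le_Rintegral => //.
- by apply: integrable_norm; exact: ihd.
- exact: (locintZ e Pb.1 abT).
- move=> x _; rewrite -mulrBl normrM (ger0_norm (hat_ge0 _ _ d0)).
  have [cx|cx] := boolP (c <= x <= c + 2 * d).
    by apply: ler_wpM2r; [exact: hat_ge0|exact: he].
  by rewrite hat_eq0// !mulr0.
Qed.

(** This is the du Bois-Reymond lemma: [h = f - G] has zero weak derivative. Testing with
    [bump d s - bump d t], whose derivative is [hat d s - hat d t], equates the averages of [h] next
    to [s] and next to [t], and these are within [e / 2] of [h s] and [h t]. *)
Lemma weak_derivative_prim T f g : open T -> is_interval T ->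
  {in T, continuous f} -> locint T g -> weak_derivative T f g -> prim T f g.
Proof.
move=> oT iT cf gT wfg; split => // s t stT.
rewrite le_eqVlt => /predU1P[->|st].
  by rewrite set_itv1 Rintegral_set1 subrr.
have Ts : T s by apply: stT; rewrite /= in_itv/= lexx ltW.
have Tt : T t by apply: stT; rewrite /= in_itv/= lexx ltW.
have [G PG _] := prim_exists iT Ts gT.
have cG := prim_continuous oT PG.
pose h x := f x - G x.
have ch : {in T, continuous h} by move=> x Tx; apply: continuousB; [exact: cf|exact: cG].
suff : h t = h s by rewrite -(PG.2 _ _ stT (ltW st)) /h; lra.
have wh phi : test_function T phi -> \int[mu]_(x in T) (h x * derive1 phi x) = 0.
  move=> tphi; have E1 := wfg _ tphi; have E2 := prim_weak_derivative oT iT PG tphi.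
  have [a [b [ab abT _ _ p0]]] := test_function_segment oT (ex_intro _ s Ts) tphi.
  have [_ cphi _] := tphi.
  have cdphi : locint T (derive1 phi) by apply: continuous_locint => x _; exact: cphi.
  have supp (k : R -> R) : \int[mu]_(x in T) (k x * derive1 phi x) =
      \int[mu]_(x in `[a, b]) (k x * derive1 phi x).
    by apply: Rintegral_support abT _ => x /p0[_ ->]; rewrite mulr0.
  have ik (k : R -> R) : {in T, continuous k} ->
      mu.-integrable `[a, b] (EFin \o (fun x => k x * derive1 phi x)).
    move=> ck; have := locintM ck cdphi abT; congr integrable.
    by apply/funext => x /=; rewrite mulrC.
  rewrite supp; have -> : \int[mu]_(x in `[a, b]) (h x * derive1 phi x) =
      \int[mu]_(x in `[a, b]) (f x * derive1 phi x - G x * derive1 phi x).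
    by apply: eq_Rintegral => x _; rewrite mulrBl.
  rewrite RintegralB//; [|exact: ik..].
  by rewrite -!supp E1 E2 subrr.
suff H e : 0 < e -> `|h t - h s| <= e.
  apply/eqP; rewrite -subr_eq0 -normr_le0; apply/ler_addgt0Pl => e e0.
  by rewrite addr0; exact: H.
move=> e0; have e2 : 0 < e / 2 by lra.
have close x : T x -> exists2 r, 0 < r &
    forall y, `|x - y| < r -> `|h y - h x| <= e / 2.
  move=> Tx; have /cvgrPdist_le/(_ _ e2)[r /= r0 rh] := ch _ (mem_set Tx).
  by exists r => // y xy; rewrite distrC; exact: rh.
have [r1 r10 h1] := close _ Ts; have [r2 r20 h2] := close _ Tt.
have [t' [t'' [t't tt'' tT]]] := open_segment oT Tt.
(* The averages look [2 * d] to the right; dividing by 3 keeps these windows strictly within the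
   continuity radii and inside [T]. *)
pose d := Num.min (Num.min r1 r2) (t'' - t) / 3.
have m0 : 0 < Num.min (Num.min r1 r2) (t'' - t) by rewrite !lt_min r10 r20; lra.
have d0 : 0 < d by rewrite divr_gt0.
have dr1 : 3 * d <= r1 by rewrite /d mulrC mulfVK// !ge_min lexx.
have dr2 : 3 * d <= r2 by rewrite /d mulrC mulfVK// !ge_min lexx orbT.
have dt : 3 * d <= t'' - t by rewrite /d mulrC mulfVK// !ge_min lexx orbT.
have abT : `[s, t + 2 * d] `<=` T.
  apply: (@segment_sub _ T) => //; apply: tT; rewrite /= in_itv/=.
  by apply/andP; split; lra.
(* Both bumps equal 1 to the right of [t + 2 * d], so the difference has compact support. *)
pose phi := bump d s - bump d t.
have dphi x : is_derive x (1 : R) phi (hat d s x - hat d t x).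
  have D1 := bump_derive s x d0; have D2 := bump_derive t x d0.
  exact: is_deriveB.
have phiE : derive1 phi = fun x => hat d s x - hat d t x.
  by apply/funext => x; rewrite derive1E; have H := dphi x; exact: derive_val.
have tphi : test_function T phi.
  split=> [x||].
  - exact: (@ex_derive _ _ _ _ _ _ _ (dphi x)).
  - by rewrite phiE => x; apply: continuousB; exact: hat_cont.
  - exists s, (t + 2 * d); split=> // x; rewrite negb_and -!ltNge /phi !fctE.
    move=> /orP[xs|xt]; first by rewrite !bump_l ?subrr//; lra.
    by rewrite !bump_r ?subrr//; lra.
have := wh _ tphi.
rewrite (Rintegral_support abT); last first.
  move=> x; rewrite phiE negb_and -!ltNge => xst.
  rewrite !hat_eq0 ?subrr ?mulr0// negb_and -!ltNge.
    by case/orP: xst => ?; apply/orP; [left|right]; lra.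
  by case/orP: xst => ?; apply/orP; [left|right]; lra.
have A1 := hat_average (e := e / 2) d0 abT ch (lexx s) _ _.
have A2 := hat_average (e := e / 2) d0 abT ch (ltW st) (lexx _) _.
have ih c : mu.-integrable `[s, t + 2 * d] (EFin \o (fun x => h x * hat d c x)).
  have chat : locint T (hat d c) by apply: continuous_locint => x _; exact: hat_cont.
  have := locintM ch chat abT; congr integrable; apply/funext => x /=.
  by rewrite mulrC.
have -> : \int[mu]_(x in `[s, t + 2 * d]) (h x * derive1 phi x) =
    \int[mu]_(x in `[s, t + 2 * d]) (h x * hat d s x - h x * hat d t x).
  by apply: eq_Rintegral => x _; rewrite phiE mulrBr.
rewrite RintegralB//; [|exact: ih..].
move: A1 A2; rewrite !ler_norml.
set X1 := Rintegral _ _ _; set X2 := Rintegral _ _ _.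
move=> /(_ _ _)/andP A1 /(_ _)/andP A2.
have {A1}[A11 A12] : - (e / 2) <= X1 - h s /\ X1 - h s <= e / 2.
  apply: A1; first lra.
  by move=> x /andP[sx xs]; apply: h1; rewrite ltr_distlC; apply/andP; split; lra.
have {A2}[A21 A22] : - (e / 2) <= X2 - h t /\ X2 - h t <= e / 2.
  apply: A2.
  by move=> x /andP[sx xs]; apply: h2; rewrite ltr_distlC; apply/andP; split; lra.
by move=> ?; apply/andP; split; lra.
Qed.

End weak_derivatives.

(** * Locally square integrable functions *)

Section lebesgue_spaces.
Context {R : realType}.
Local Notation mu := (@lebesgue_measure R).
Implicit Types (f g : R -> R) (a b c s t : R) (T : set R).

Definition locL2 T f := forall a b, `[a, b] `<=` T ->
  measurable_fun `[a, b] f /\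
  mu.-integrable `[a, b] (EFin \o (fun t => f t ^+ 2)).

Lemma integrable_segment f a b :
  mu.-integrable setT (EFin \o f \_ `[a, b]) <->
  mu.-integrable `[a, b] (EFin \o f).
Proof.
rewrite -restrict_EFin.
by have [] := @integrable_mkcond _ _ _ mu `[a, b] (EFin \o f) (measurable_itv _).
Qed.

Lemma Lfun1_segment f a b :
  f \_ `[a, b] \in Lfun mu 1%E <-> mu.-integrable `[a, b] (EFin \o f).
Proof. by rewrite Lfun1_integrable integrable_segment. Qed.

Lemma measurable_segment f a b :
  measurable_fun setT (f \_ `[a, b]) <-> measurable_fun `[a, b] f.
Proof. by have [] := measurable_restrictT f (measurable_itv `[a, b]). Qed.

Lemma patch_sqr f a b :
  (fun t => (f \_ `[a, b]) t ^+ 2) = (fun t => f t ^+ 2) \_ `[a, b].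
Proof.
apply/funext => t; rewrite !patchE; case: ifPn => // _.
by rewrite expr0n.
Qed.

Lemma Lfun2_segment f a b : f \_ `[a, b] \in Lfun mu 2%:E <->
  measurable_fun `[a, b] f /\
  mu.-integrable `[a, b] (EFin \o (fun t => f t ^+ 2)).
Proof.
split=> [f2|[mf f2]].
  split; last first.
    by apply/integrable_segment; rewrite -patch_sqr; exact: Lfun2_integrable_sqr.
  move: f2; rewrite inE => /andP[]; rewrite inE/= => mf _.
  by apply/measurable_segment.
have mf' : measurable_fun setT (f \_ `[a, b]) by apply/measurable_segment.
rewrite inE; apply/andP; split; first by rewrite inE.
rewrite inE/= /finite_norm unlock poweR_lty//.
have /integrable_segment := f2; rewrite -patch_sqr => /integrableP[_].
apply: le_lt_trans; apply: ge0_le_integral => //.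
- by move=> t _; exact: poweR_ge0.
- apply/measurable_EFinP.
  apply/(@measurableT_comp _ _ _ _ _ _ (fun x : R => x `^ 2)%R) => //.
  exact/measurableT_comp.
- by apply: measurableT_comp => //; apply/measurable_EFinP; exact: measurable_funX.
- by move=> t _/=; rewrite lee_fin normrX powR_mulrn.
Qed.

(** On a segment of finite length an essentially bounded function is square integrable; in this way
    [D] is treated like the other coefficients. *)
Lemma Lfunoo_segment f a b : f \_ `[a, b] \in Lfun mu +oo%E ->
  measurable_fun `[a, b] f /\
  mu.-integrable `[a, b] (EFin \o (fun t => f t ^+ 2)).
Proof.
rewrite inE => /andP[]; rewrite !inE/= => mf'.
have mf : measurable_fun `[a, b] f by apply/measurable_segment.
move=> finf; split => //.
have [M fM] : exists M : R, {ae mu, forall t, (`|(f \_ `[a, b]) t|%:E <= M%:E)%E}.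
  move: finf; rewrite /finite_norm unlock /=.
  (* The norm at exponent infinity is an essential supremum only if the whole line has positive
     measure, which [[0, 1]] witnesses. *)
  rewrite ifT; last first.
    rewrite (@lt_le_trans _ _ (mu `[0, 1]%classic))//.
      by rewrite lebesgue_measure_itv/= lte_fin ltr01 oppr0 adde0 lte_fin.
    by apply: le_measure; rewrite ?inE.
  move=> fin; have [M HM] : exists M : R,
      (ess_sup mu (abse \o (EFin \o f \_ `[a, b])) <= M%:E)%E.
    by case: ess_sup fin => [r _| //|_]; [exists r|exists 0; rewrite leNye].
  by exists M; move/ess_supP : HM.
apply/integrableP; split.
  by apply/measurable_EFinP; exact: measurable_funX.
apply: (@le_lt_trans _ _ (\int[mu]_(t in `[a, b]) (M ^+ 2)%:E)%E).
  apply: ae_ge0_le_integral => //.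
  - by do 2 apply: measurableT_comp => //; exact: measurable_funX.
  - by move=> t _; rewrite lee_fin sqr_ge0.
  apply: ae_imply fM => t ftM tab; move: ftM; rewrite patchE mem_set// !lee_fin.
  move=> ftM; rewrite /= normrX; apply: lerXn2r => //; rewrite nnegrE//.
  exact: le_trans ftM.
rewrite integral_cst//= lebesgue_measure_itv/=; case: ifPn => _.
  by rewrite -EFinB -EFinM ltry.
by rewrite mule0.
Qed.

Lemma locL2_mul T f g : locL2 T f -> locL2 T g -> locint T (fun t => f t * g t).
Proof.
move=> fT gT a b abT; have [mf f2] := fT _ _ abT; have [mg g2] := gT _ _ abT.
have := integrableD _ f2 g2 => /(_ (measurable_itv _)); apply: le_integrable => //.
  by apply/measurable_EFinP; exact: measurable_funM.
move=> x _ /=; rewrite lee_fin [leRHS]ger0_norm ?addr_ge0 ?sqr_ge0//.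
rewrite normrM -(real_normK (num_real (f x))) -(real_normK (num_real (g x))).
have := normr_ge0 (f x); have := normr_ge0 (g x).
by move: `|f x| `|g x| => u v ? ?; have := sqr_ge0 (u - v); nra.
Qed.

Lemma continuous_locL2 T f : {in T, continuous f} -> locL2 T f.
Proof.
move=> cf a b abT; split.
  apply: subspace_continuous_measurable_fun => //.
  exact: (continuous_in_segment cf).
by have := locintM cf (continuous_locint cf) abT.
Qed.

Lemma locL2_locint T f : locL2 T f -> locint T f.
Proof.
move=> fT; have c1 : {in T, continuous (fun=> 1 : R)} by move=> x _; exact: cvg_cst.
by have := locL2_mul fT (continuous_locL2 c1); under eq_fun do rewrite mulr1.
Qed.

Lemma locL2D T f g : locL2 T f -> locL2 T g -> locL2 T (fun t => f t + g t).
Proof.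
move=> fT gT a b abT; have [mf f2] := fT _ _ abT; have [mg g2] := gT _ _ abT.
split; first exact: measurable_funD.
have fg := locintZ 2 (locL2_mul fT gT) abT.
have := integrableD _ (integrableD _ f2 g2) fg.
move=> /(_ (measurable_itv _) (measurable_itv _)).
by congr integrable; apply/funext => x /=; congr EFin; ring.
Qed.

Lemma locL2N T f : locL2 T f -> locL2 T (fun t => - f t).
Proof.
move=> fT a b abT; have [mf f2] := fT _ _ abT; split; first exact: measurable_funN.
by move: f2; congr integrable; apply/funext => x /=; rewrite sqrrN.
Qed.

Lemma locL2M T f g : {in T, continuous g} -> locL2 T f ->
  locL2 T (fun t => f t * g t).
Proof.
move=> cg fT a b abT; have [mf f2] := fT _ _ abT; split.
  by apply: measurable_funM => //; exact: (continuous_locL2 cg abT).1.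
have cg2 : {in T, continuous (fun t => g t ^+ 2)}.
  by move=> t Tt; apply: continuousM; exact: cg.
have f2T : locint T (fun t => f t ^+ 2) by move=> p q pq; exact: (fT _ _ pq).2.
have := locintM cg2 f2T abT; congr integrable; apply/funext => x /=.
by rewrite exprMn.
Qed.

End lebesgue_spaces.

(** * Complex matrix functions *)

Section complex_calculus.
Local Open Scope complex_scope.
Local Open Scope sesquilinear_scope.
Context {R : realType}.
Local Notation C := R[i].
Local Notation mu := (@lebesgue_measure R).
Local Notation Re := complex.Re.
Local Notation Im := complex.Im.
Implicit Types (T : set R) (F f G g : R -> C) (t : R).

Lemma Re_mul (x y : C) : Re (x * y) = Re x * Re y - Im x * Im y.
Proof. by case: x y => [a b] [c d]. Qed.

Lemma Im_mul (x y : C) : Im (x * y) = Re x * Im y + Im x * Re y.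
Proof. by case: x y => [a b] [c d]. Qed.

Lemma Re_add (x y : C) : Re (x + y) = Re x + Re y.
Proof. exact: raddfD. Qed.

Lemma Im_add (x y : C) : Im (x + y) = Im x + Im y.
Proof. exact: raddfD. Qed.

Lemma Re_cconj (x : C) : Re (Num.conj x) = Re x.
Proof. by case: x. Qed.

Lemma Im_cconj (x : C) : Im (Num.conj x) = - Im x.
Proof. by case: x. Qed.

Definition cprim T F f :=
  prim T (fun t => Re (F t)) (fun t => Re (f t)) /\
  prim T (fun t => Im (F t)) (fun t => Im (f t)).

Lemma cprimM T F f G g : open T -> is_interval T ->
  cprim T F f -> cprim T G g ->
  cprim T (fun t => F t * G t) (fun t => f t * G t + F t * g t).
Proof.
move=> oT iT [F1 F2] [G1 G2].
have M11 := primM iT oT F1 G1; have M12 := primM iT oT F1 G2.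
have M21 := primM iT oT F2 G1; have M22 := primM iT oT F2 G2.
split.
- under eq_fun do rewrite Re_mul.
  apply: eq_prim (primB M11 M22) => t _; rewrite Re_add !Re_mul; ring.
- under eq_fun do rewrite Im_mul.
  apply: eq_prim (primD M12 M21) => t _; rewrite Im_add !Im_mul; ring.
Qed.

Lemma cprim_sum T (I : Type) (r : seq I) (F f : I -> R -> C) :
  (forall i, cprim T (F i) (f i)) ->
  cprim T (fun t => \sum_(i <- r) F i t) (fun t => \sum_(i <- r) f i t).
Proof.
move=> Ff; split.
- under eq_fun do rewrite raddf_sum/=.
  under [X in prim _ _ X]eq_fun do rewrite raddf_sum/=.
  by apply: prim_sum => i; have [] := Ff i.
- under eq_fun do rewrite raddf_sum/=.
  under [X in prim _ _ X]eq_fun do rewrite raddf_sum/=.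
  by apply: prim_sum => i; have [] := Ff i.
Qed.

Definition mprim T p q (M dM : R -> 'M[C]_(p, q)) :=
  forall i j, cprim T (fun t => M t i j) (fun t => dM t i j).

Lemma eq_mprim T p q (M dM dN : R -> 'M[C]_(p, q)) :
  (forall t, T t -> dM t = dN t) -> mprim T M dM -> mprim T M dN.
Proof.
move=> E MdM i j; have [H1 H2] := MdM i j.
by split; [apply: eq_prim H1|apply: eq_prim H2] => t; rewrite inE => Tt; rewrite E.
Qed.

Lemma mprimM T p q r (M dM : R -> 'M[C]_(p, q)) (N dN : R -> 'M[C]_(q, r)) :
  open T -> is_interval T -> mprim T M dM -> mprim T N dN ->
  mprim T (fun t => M t *m N t) (fun t => dM t *m N t + M t *m dN t).
Proof.
move=> oT iT MdM NdN i j.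
under eq_fun do rewrite mxE.
under [X in cprim _ _ X]eq_fun do rewrite !mxE -big_split/=.
by apply: cprim_sum => k; exact: cprimM.
Qed.

Lemma cprimZ T (c : C) F f : cprim T F f ->
  cprim T (fun t => c * F t) (fun t => c * f t).
Proof.
move=> [F1 F2]; split.
- under eq_fun do rewrite Re_mul.
  apply: eq_prim (primB (primZ (Re c) F1) (primZ (Im c) F2)) => t _.
  by rewrite Re_mul.
- under eq_fun do rewrite Im_mul.
  apply: eq_prim (primD (primZ (Re c) F2) (primZ (Im c) F1)) => t _.
  by rewrite Im_mul.
Qed.

Lemma mprim_mull T p q r (M dM : R -> 'M[C]_(p, q)) (c : 'M[C]_(r, p)) :
  mprim T M dM -> mprim T (fun t => c *m M t) (fun t => c *m dM t).
Proof.
move=> MdM i j; under eq_fun do rewrite mxE.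
under [X in cprim _ _ X]eq_fun do rewrite mxE.
by apply: cprim_sum => k; exact: cprimZ.
Qed.

Lemma mprim_tr T p q (M dM : R -> 'M[C]_(p, q)) : mprim T M dM ->
  mprim T (fun t => (M t)^T) (fun t => (dM t)^T).
Proof.
move=> MdM i j; under eq_fun do rewrite mxE.
by under [X in cprim _ _ X]eq_fun do rewrite mxE.
Qed.

Lemma mprim_mulr T p q r (M dM : R -> 'M[C]_(p, q)) (c : 'M[C]_(q, r)) :
  mprim T M dM -> mprim T (fun t => M t *m c) (fun t => dM t *m c).
Proof.
move=> /mprim_tr/(mprim_mull c^T)/mprim_tr.
under eq_fun do rewrite trmx_mul !trmxK.
by under [X in mprim _ _ X]eq_fun do rewrite trmx_mul !trmxK.
Qed.

Lemma mprim_ctr T p q (M dM : R -> 'M[C]_(p, q)) : mprim T M dM ->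
  mprim T (fun t => (M t)^t*) (fun t => (dM t)^t*).
Proof.
move=> MdM i j; have [H1 H2] := MdM j i; split.
- under eq_fun do rewrite !mxE Re_cconj.
  by under [X in prim _ _ X]eq_fun do rewrite !mxE Re_cconj.
- under eq_fun do rewrite !mxE Im_cconj.
  by under [X in prim _ _ X]eq_fun do rewrite !mxE Im_cconj; exact: primN.
Qed.

Lemma mprim0_cst T p q (M : R -> 'M[C]_(p, q)) : is_interval T ->
  mprim T M (fun=> 0) -> forall s t, T s -> T t -> M s = M t.
Proof.
move=> iT MdM s t Ts Tt.
wlog st : s t Ts Tt / s <= t.
  by move=> H; have [/H|/ltW /H] := leP s t; [exact|move=> /(_ Tt Ts)].
apply/matrixP => i j; have [[_ H1] [_ H2]] := MdM i j.
have stT := segment_sub iT Ts Tt.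
have := H1 _ _ stT st; have := H2 _ _ stT st.
rewrite !mxE !Rintegral_cst// !mul0r.
case: (M t i j) (M s i j) => [a b] [c d] /= /eqP + /eqP.
by rewrite !subr_eq0 => /eqP -> /eqP ->.
Qed.

Definition mcont T p q (M : R -> 'M[C]_(p, q)) :=
  mx_all (fun f : R -> R => {in T, continuous f}) M.

Lemma mprim_mcont T p q (M dM : R -> 'M[C]_(p, q)) : open T ->
  mprim T M dM -> mcont T M.
Proof.
by move=> oT MdM i j; have [H1 H2] := MdM i j; split;
  [exact: prim_continuous H1|exact: prim_continuous H2].
Qed.

(** One argument for three classes, namely continuous, locally integrable and locally square
    integrable functions: each contains zero and is stable under sums, opposites and products with
    continuous functions. *)
Lemma mx_all_mulr T (P : (R -> R) -> Prop) p q r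
    (M : R -> 'M[C]_(p, q)) (N : R -> 'M[C]_(q, r)) :
  P (fun=> 0) -> (forall f g : R -> R, P f -> P g -> P (fun t => f t + g t)) ->
  (forall f : R -> R, P f -> P (fun t => - f t)) ->
  (forall f g : R -> R, {in T, continuous g} -> P f -> P (fun t => f t * g t)) ->
  mx_all P M -> mcont T N -> mx_all P (fun t => M t *m N t).
Proof.
move=> P0 PD PN PM HM HN i j.
have Psum (s : seq 'I_q) (h : 'I_q -> R -> R) : (forall k, P (h k)) ->
    P (fun t => \sum_(k <- s) h k t).
  move=> Ph; elim: s => [|k s IH]; first by under eq_fun do rewrite big_nil.
  by under eq_fun do rewrite big_cons; exact: PD.
have [MR MI] : (forall k, P (fun t => Re (M t i k))) /\
    (forall k, P (fun t => Im (M t i k))) by split => k; have [] := HM i k.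
have [NR NI] : (forall k, {in T, continuous (fun t => Re (N t k j))}) /\
    (forall k, {in T, continuous (fun t => Im (N t k j))}).
  by split => k; have [] := HN k j.
split.
- under eq_fun do (rewrite mxE raddf_sum/=; under eq_bigr do rewrite Re_mul).
  by apply: Psum => k; apply: (PD _ _ _ (PN _ _)); exact: PM.
- under eq_fun do (rewrite mxE raddf_sum/=; under eq_bigr do rewrite Im_mul).
  by apply: Psum => k; apply: PD; exact: PM.
Qed.

Lemma mx_allD (P : (R -> R) -> Prop) p q (M N : R -> 'M[C]_(p, q)) :
  (forall f g : R -> R, P f -> P g -> P (fun t => f t + g t)) ->
  mx_all P M -> mx_all P N -> mx_all P (fun t => M t + N t).
Proof.
move=> PD HM HN i j; have [M1 M2] := HM i j; have [N1 N2] := HN i j; split.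
- by under eq_fun do rewrite mxE Re_add; exact: PD.
- by under eq_fun do rewrite mxE Im_add; exact: PD.
Qed.

Lemma mprim_exists T p q (M : R -> 'M[C]_(p, q)) : is_interval T ->
  mx_all (locint T) M -> exists N, mprim T N M.
Proof.
move=> iT HM; have [[t0 Tt0]|T0] := pselect (T !=set0); last first.
  exists M => i j; have [H1 H2] := HM i j.
  by split; split => // a b abT ab; exfalso; apply: T0; exists a; apply: abT;
    rewrite /= in_itv/= lexx.
exists (fun t => \matrix_(i, j) (indef t0 (fun s => Re (M s i j)) t +i*
                                 indef t0 (fun s => Im (M s i j)) t)) => i j.
have [H1 H2] := HM i j.
by split; under eq_fun do rewrite mxE /=; exact: prim_indef.
Qed.

Definition cder t F (d : C) := is_derive t (1 : R) (fun s => Re (F s)) (Re d) /\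
  is_derive t (1 : R) (fun s => Im (F s)) (Im d).

Lemma cderM t F G (f g : C) : cder t F f -> cder t G g ->
  cder t (fun s => F s * G s) (f * G t + F t * g).
Proof.
move=> [F1 F2] [G1 G2]; split.
- under eq_fun do rewrite Re_mul.
  apply: is_derive_eq (is_deriveB (is_deriveM F1 G1) (is_deriveM F2 G2)) _.
  by rewrite Re_add !Re_mul /GRing.scale/=; ring.
- under eq_fun do rewrite Im_mul.
  apply: is_derive_eq (is_deriveD (is_deriveM F1 G2) (is_deriveM F2 G1)) _.
  by rewrite Im_add !Im_mul /GRing.scale/=; ring.
Qed.

Lemma cder_sum t (I : Type) (r : seq I) (F : I -> R -> C) (f : I -> C) :
  (forall i, cder t (F i) (f i)) ->
  cder t (fun s => \sum_(i <- r) F i s) (\sum_(i <- r) f i).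
Proof.
move=> Ff; elim: r => [|i r [IH1 IH2]].
  under eq_fun do rewrite big_nil; rewrite big_nil.
  by split; exact: is_derive_cst.
have [F1 F2] := Ff i.
under eq_fun do rewrite big_cons; rewrite big_cons; split.
- by under eq_fun do rewrite Re_add; rewrite Re_add; exact: is_deriveD.
- by under eq_fun do rewrite Im_add; rewrite Im_add; exact: is_deriveD.
Qed.

Definition mder t p q (M : R -> 'M[C]_(p, q)) (d : 'M[C]_(p, q)) :=
  forall i j, cder t (fun s => M s i j) (d i j).

Lemma mder_cst t p q (c : 'M[C]_(p, q)) : mder t (fun=> c) 0.
Proof. by move=> i j; rewrite mxE; split; exact: is_derive_cst. Qed.

Lemma mderM t p q r (M : R -> 'M[C]_(p, q)) dM (N : R -> 'M[C]_(q, r)) dN :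
  mder t M dM -> mder t N dN ->
  mder t (fun s => M s *m N s) (dM *m N t + M t *m dN).
Proof.
move=> MdM NdN i j; under eq_fun do rewrite mxE.
by rewrite !mxE -big_split/=; apply: cder_sum => k; exact: cderM (MdM i k) (NdN k j).
Qed.

Lemma mder_ctr t p q (M : R -> 'M[C]_(p, q)) dM : mder t M dM ->
  mder t (fun s => (M s)^t*) (dM^t*).
Proof.
move=> MdM i j; have [H1 H2] := MdM j i; rewrite !mxE; split.
- by under eq_fun do rewrite !mxE Re_cconj; rewrite Re_cconj.
- by under eq_fun do rewrite !mxE Im_cconj; rewrite Im_cconj; exact: is_deriveN.
Qed.

Lemma mxderivable_mder t p q (M : R -> 'M[C]_(p, q)) :
  mxderivable M t -> mder t M (mxderiv M t).
Proof.
move=> dM i j; have [H1 H2] := dM i j; rewrite mxE /=.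
by split=> /=; [apply: (DeriveDef H1)|apply: (DeriveDef H2)]; rewrite derive1E.
Qed.

Lemma mprim_mder T p q (M dM : R -> 'M[C]_(p, q)) : open T -> mprim T M dM ->
  {ae mu, forall t, T t -> mder t M (dM t)}.
Proof.
move=> oT MdM.
have : {ae mu, forall t, forall ij : 'I_p * 'I_q,
    T t -> cder t (fun s => M s ij.1 ij.2) (dM t ij.1 ij.2)}.
  apply: ae_fin => -[i j] /=; have [H1 H2] := MdM i j.
  have := ae_and (prim_derive oT H1) (prim_derive oT H2).
  by apply: ae_imply => t [D1 D2] Tt; split; [exact: D1|exact: D2].
by apply: ae_imply => t H Tt i j; exact: (H (i, j)).
Qed.

End complex_calculus.

(** * Fundamental matrices and the quadratic form of the KYP matrix *)

Section systems.
Local Open Scope complex_scope.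
Local Open Scope sesquilinear_scope.
Context {R : realType}.
Local Notation C := R[i].
Local Notation mu := (@lebesgue_measure R).
Local Notation Re := complex.Re.
Local Notation Im := complex.Im.
Implicit Types (T : set R) (t : R).

Lemma Re_addmx p q (M N : 'M[C]_(p, q)) i j :
  Re ((M + N) i j) = Re (M i j) + Re (N i j).
Proof. by rewrite mxE Re_add. Qed.

Lemma Re_submx p q (M N : 'M[C]_(p, q)) i j :
  Re ((M - N) i j) = Re (M i j) - Re (N i j).
Proof. by rewrite !mxE Re_add raddfN. Qed.

Lemma Re_mulmx p q r (M : 'M[C]_(p, q)) (N : 'M[C]_(q, r)) i j :
  Re ((M *m N) i j) = \sum_k (Re (M i k) * Re (N k j) - Im (M i k) * Im (N k j)).
Proof. by rewrite mxE raddf_sum; apply: eq_bigr => k _; exact: Re_mul. Qed.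

Lemma Im_mulmx p q r (M : 'M[C]_(p, q)) (N : 'M[C]_(q, r)) i j :
  Im ((M *m N) i j) = \sum_k (Re (M i k) * Im (N k j) + Im (M i k) * Re (N k j)).
Proof. by rewrite mxE raddf_sum; apply: eq_bigr => k _; exact: Im_mul. Qed.

Lemma sum_pair_bool (I : finType) (F : I * bool -> R) :
  \sum_k F k = \sum_i (F (i, true) + F (i, false)).
Proof.
rewrite (eq_bigr (fun k => F (k.1, k.2))); last by case.
rewrite -(pair_bigA _ (fun i b => F (i, b))).
by apply: eq_bigr => i _; rewrite big_bool.
Qed.

Lemma complex_linear_ode T t0 N (M : R -> 'M[C]_N) (v : 'cV[C]_N) :
  open T -> is_interval T -> T t0 -> mx_all (locint T) M ->
  exists x : R -> 'cV[C]_N, mprim T x (fun t => M t *m x t) /\ x t0 = v.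
Proof.
move=> oT iT Tt0 HM.
(* Real form of the system: [true] marks imaginary parts, and [a] has diagonal blocks [Re M] and
   off-diagonal blocks [- Im M] and [Im M]. *)
pose a (k l : 'I_N * bool) t := match k.2, l.2 with
  | false, true => - Im (M t k.1 l.1)
  | true, false => Im (M t k.1 l.1)
  | _, _ => Re (M t k.1 l.1)
  end.
pose c (k : 'I_N * bool) := if k.2 then Im (v k.1 0) else Re (v k.1 0).
have a_int k l : locint T (a k l).
  have [H1 H2] := HM k.1 l.1; rewrite /a.
  by case: k.2; case: l.2 => //; exact: locintN.
have [z [z_prim z0]] := linear_ode c oT iT Tt0 a_int.
exists (fun t => \col_i (z (i, false) t +i* z (i, true) t)); split; last first.
  apply/colP => i; rewrite mxE !z0 /c /=.
  by case: (v i 0).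
move=> i j; split.
- under eq_fun do rewrite mxE /=.
  apply: eq_prim (z_prim (i, false)) => t _.
  rewrite Re_mulmx sum_pair_bool; apply: eq_bigr => k _; rewrite !mxE /a /=; ring.
- under eq_fun do rewrite mxE /=.
  apply: eq_prim (z_prim (i, true)) => t _.
  rewrite Im_mulmx sum_pair_bool; apply: eq_bigr => k _; rewrite !mxE /a /=; ring.
Qed.

Lemma fundamental_matrix_at T t0 N (M : R -> 'M[C]_N) :
  open T -> is_interval T -> T t0 -> mx_all (locint T) M ->
  exists X : R -> 'M[C]_N, mprim T X (fun t => M t *m X t) /\ X t0 = 1%:M.
Proof.
move=> oT iT Tt0 HM.
have /choice[x xP] (k : 'I_N) : exists x : R -> 'cV[C]_N,
    mprim T x (fun t => M t *m x t) /\ x t0 = col k 1%:M.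
  exact: complex_linear_ode.
exists (fun t => \matrix_(i, j) x j t i 0); split; last first.
  by apply/matrixP => i j; rewrite mxE (xP j).2 mxE.
move=> i j; under eq_fun do rewrite mxE.
under [X in cprim _ _ X]eq_fun do (rewrite mxE; under eq_bigr do rewrite mxE).
by have := (xP j).1 i 0; under [X in cprim _ _ X]eq_fun do rewrite mxE.
Qed.

(** The inverse comes from the dual equation [Y' = - M^T Y]: the product [Y^T X] has zero derivative
    and equals the identity at [t0], hence everywhere on [T]. *)
Lemma fundamental_matrix T t0 N (M : R -> 'M[C]_N) :
  open T -> is_interval T -> T t0 -> mx_all (locint T) M ->
  exists X Y : R -> 'M[C]_N, mprim T X (fun t => M t *m X t) /\
    forall t, T t -> X t *m Y t = 1%:M.
Proof.
move=> oT iT Tt0 HM.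
have [X [Xp X0]] := fundamental_matrix_at oT iT Tt0 HM.
have HN : mx_all (locint T) (fun t => - (M t)^T).
  move=> i j; have [H1 H2] := HM j i; split.
  - by under eq_fun do rewrite !mxE raddfN/=; exact: locintN.
  - by under eq_fun do rewrite !mxE raddfN/=; exact: locintN.
have [Y [Yp Y0]] := fundamental_matrix_at oT iT Tt0 HN.
exists X, (fun t => (Y t)^T); split => // t Tt.
apply: mulmx1C.
have := mprimM oT iT (mprim_tr Yp) Xp; move=> H.
have {}H : mprim T (fun t => (Y t)^T *m X t) (fun=> 0).
  apply: eq_mprim H => s _.
  by rewrite trmx_mul linearN/= trmxK mulmxN mulNmx mulmxA addrC subrr.
by rewrite (mprim0_cst iT H Tt Tt0) Y0 X0 trmx1 mulmx1.
Qed.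

Lemma Lp_loc1P T p q (M : R -> 'M[C]_(p, q)) :
  Lp_loc 1%E T M <-> mx_all (locint T) M.
Proof.
split=> [H i j|H a b abT i j].
  by split=> a b /H/(_ i j)[H1 H2]; apply/Lfun1_segment.
by have [H1 H2] := H i j; split; apply/Lfun1_segment; [exact: H1|exact: H2].
Qed.

Lemma Lp_loc2P T p q (M : R -> 'M[C]_(p, q)) :
  Lp_loc 2%:E T M <-> mx_all (locL2 T) M.
Proof.
split=> [H i j|H a b abT i j].
  by split=> a b /H/(_ i j)[H1 H2]; apply/Lfun2_segment.
by have [H1 H2] := H i j; split; apply/Lfun2_segment; [exact: H1|exact: H2].
Qed.

Lemma Lp_locoo T p q (M : R -> 'M[C]_(p, q)) :
  Lp_loc +oo%E T M -> mx_all (locL2 T) M.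
Proof.
by move=> H i j; split=> a b /H/(_ i j)[H1 H2]; exact: Lfunoo_segment.
Qed.

Lemma W11_loc_mprim T p q (x dx : R -> 'M[C]_(p, q)) : open T -> is_interval T ->
  W11_loc T x dx -> mprim T x dx.
Proof.
move=> oT iT [cx _ /Lp_loc1P dxT wd] i j.
have [c1 c2] := cx i j; have [d1 d2] := dxT i j; have [w1 w2] := wd i j.
by split; apply: weak_derivative_prim => //; rewrite -continuous_open_subspace.
Qed.

Lemma mprim_W11_loc T p q (x dx : R -> 'M[C]_(p, q)) : open T -> is_interval T ->
  mprim T x dx -> W11_loc T x dx.
Proof.
move=> oT iT xdx; have cx := mprim_mcont oT xdx; split.
- by move=> i j; have [c1 c2] := cx i j; rewrite !continuous_open_subspace.
- apply/Lp_loc1P => i j; have [c1 c2] := cx i j.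
  by split; exact: continuous_locint.
- by apply/Lp_loc1P => i j; have [[H1 _] [H2 _]] := xdx i j.
- by move=> i j; have [H1 H2] := xdx i j; split; exact: prim_weak_derivative.
Qed.

Lemma trmxC_mul p q r (M : 'M[C]_(p, q)) (N : 'M[C]_(q, r)) :
  (M *m N)^t* = N^t* *m M^t*.
Proof. by rewrite trmx_mul map_mxM. Qed.

Lemma trmxCD p q (M N : 'M[C]_(p, q)) : (M + N)^t* = M^t* + N^t*.
Proof. by rewrite linearD/= map_mxD. Qed.

Lemma trmxCZ p q (c : C) (M : 'M[C]_(p, q)) : (c *: M)^t* = Num.conj c *: M^t*.
Proof. by rewrite linearZ/= map_mxZ. Qed.

(** For a trajectory with derivative [xi] the subtracted bracket is what the product rule gives as
    derivative of [x^H Q x]. Both directions of the theorem pass between trajectories and matrices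
    through this identity. *)
Lemma KYP_quadratic n m (A : R -> 'M[C]_n) (B : R -> 'M[C]_(n, m))
    (Cm : R -> 'M[C]_(m, n)) (D : R -> 'M[C]_m) (Q : R -> 'M[C]_n) t
    (x : 'cV[C]_n) (u : 'cV[C]_m) :
  let xi := A t *m x + B t *m u in let y := Cm t *m x + D t *m u in
  (col_mx x u)^t* *m KYP_mx A B Cm D Q t *m col_mx x u =
  y^t* *m u + u^t* *m y -
  (xi^t* *m Q t *m x + x^t* *m mxderiv Q t *m x + x^t* *m Q t *m xi).
Proof.
move=> xi y; rewrite /KYP_mx tr_col_mx map_row_mx mul_row_block mul_row_col.
rewrite /xi /y !linearD/= !map_mxD/= !trmxC_mul.
rewrite !(mulmxDl, mulmxDr, mulmxBl, mulmxBr, mulmxN, mulNmx) !mulmxA.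
(* Each product is generalized to an opaque matrix, after which only additive arithmetic remains. *)
move: (x ^t* *m _ ^t* *m _ *m x) (_ *m A t *m x) (_ *m mxderiv Q t *m _).
move: (_ *m Cm t *m _) (u ^t* *m _ ^t* *m _ *m x) (_ *m Cm t ^t* *m _).
move: (_ *m B t *m _) (_ *m D t *m _) (_ *m D t ^t* *m _).
by move=> *; apply/matrixP => i j; rewrite !mxE; ring.
Qed.

Lemma Re_ctr p (M : 'M[C]_p) i : Re ((M^t*) i i) = Re (M i i).
Proof. by rewrite !mxE Re_cconj. Qed.

Lemma hermsymmxE p (M : 'M[C]_p) : (M \is hermsymmx) = (M == M^t*).
Proof. by apply/is_hermitianmxP/eqP; rewrite expr0 scale1r. Qed.

(** For Hermitian [M] the number [v^H M v] is its own conjugate, so positivity is a statement about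
    its real part. *)
Lemma psdmxP p (M : 'M[C]_p) : psdmx M <->
  M^t* = M /\ forall v : 'cV[C]_p, 0 <= Re ((v^t* *m M *m v) 0 0).
Proof.
rewrite /psdmx hermsymmxE; split=> [[/eqP MH M0]|[MH M0]].
  by split=> // v; have := M0 v; rewrite lecE => /andP[].
split=> [|v]; first by rewrite MH.
rewrite lecE M0 andbT; apply/eqP => /=.
have : (v^t* *m M *m v)^t* = v^t* *m M *m v.
  by rewrite !trmxC_mul trmxCK MH mulmxA.
move=> /(congr1 (fun N : 'M[C]_1 => Im (N 0 0))); rewrite !mxE Im_cconj.
by move: (Im _) => r; lra.
Qed.

Lemma mxderiv_hermitian T p (Q : R -> 'M[C]_p) t : open T -> T t ->
  (forall s, T s -> (Q s)^t* = Q s) -> mxderivable Q t ->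
  (mxderiv Q t)^t* = mxderiv Q t.
Proof.
move=> oT Tt QH dQ; apply/matrixP => i j; rewrite !mxE.
have nT : \forall s \near t, T s by exact: open_nbhs_nbhs.
have H : \forall s \near t, Q s j i = Num.conj (Q s i j).
  near=> s; have /QH E : T s by near: s; exact: nT.
  by rewrite -{1}E !mxE.
have -> : derive1 (fun s => Re (Q s j i)) t = derive1 (fun s => Re (Q s i j)) t.
  rewrite !derive1E; apply: near_eq_derive.
  by near=> s; have -> : Q s j i = Num.conj (Q s i j); [near: s; exact: H|rewrite Re_cconj].
have -> : derive1 (fun s => Im (Q s j i)) t = - derive1 (fun s => Im (Q s i j)) t.
  rewrite !derive1E -deriveN; last by have [] := dQ i j.
  apply: near_eq_derive.
  by near=> s; have -> : Q s j i = Num.conj (Q s i j); [near: s; exact: H|rewrite Im_cconj].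
by apply/eqP; rewrite eq_complex /= opprK !eqxx.
Unshelve. all: by end_near. Qed.

Section KYP.
Context {n m : nat} (T : set R).
Context (A : R -> 'M[C]_n) (B : R -> 'M[C]_(n, m)).
Context (Cm : R -> 'M[C]_(m, n)) (D : R -> 'M[C]_m).

Lemma KYP_mx_hermitian (Q : R -> 'M[C]_n) t : (Q t)^t* = Q t ->
  (mxderiv Q t)^t* = mxderiv Q t ->
  (KYP_mx A B Cm D Q t)^t* = KYP_mx A B Cm D Q t.
Proof.
move=> QH dQH; rewrite /KYP_mx tr_block_mx map_block_mx.
rewrite !linearD !linearN /= !map_mxD !map_mxN !trmxC_mul !trmxCK QH dQH.
congr block_mx; first by rewrite [X in X - _]addrC.
by rewrite addrC.
Qed.

Lemma Re_KYP_quadratic (Q : R -> 'M[C]_n) t (x : 'cV[C]_n) (u : 'cV[C]_m) :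
  let xi := A t *m x + B t *m u in let y := Cm t *m x + D t *m u in
  Re (((col_mx x u)^t* *m KYP_mx A B Cm D Q t *m col_mx x u) 0 0) =
  2 * Re ((y^t* *m u) 0 0) -
  Re ((xi^t* *m Q t *m x + x^t* *m mxderiv Q t *m x + x^t* *m Q t *m xi) 0 0).
Proof.
move=> xi y; rewrite KYP_quadratic -/xi -/y.
rewrite mxE Re_add [X in _ + Re X]mxE raddfN/=; congr (_ - _).
rewrite mxE Re_add -(Re_ctr (u^t* *m y)) trmxC_mul trmxCK; ring.
Qed.

Lemma KYP_psd_of_Re (Q : R -> 'M[C]_n) t : open T -> T t ->
  (forall s, T s -> psdmx (Q s)) -> mxderivable Q t ->
  (forall (x : 'cV[C]_n) (u : 'cV[C]_m),
    0 <= Re (((col_mx x u)^t* *m KYP_mx A B Cm D Q t *m col_mx x u) 0 0)) ->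
  psdmx (KYP_mx A B Cm D Q t).
Proof.
move=> oT Tt Qpsd dQ H; apply/psdmxP; split.
  have QH s : T s -> (Q s)^t* = Q s by move=> /Qpsd/psdmxP[].
  by apply: KYP_mx_hermitian; [exact: QH|exact: mxderiv_hermitian oT Tt QH dQ].
by move=> v; rewrite -[v]vsubmxK; exact: H.
Qed.

End KYP.

End systems.

(** * From storage functions to the KYP inequality *)

Section necessity.
Local Open Scope complex_scope.
Local Open Scope sesquilinear_scope.
Context {R : realType}.
Local Notation C := R[i].
Local Notation mu := (@lebesgue_measure R).
Local Notation Re := complex.Re.
Local Notation Im := complex.Im.

Lemma is_derive_ge0 (T : set R) (g : R -> R) (t d : R) : open T -> T t ->
  (forall s r, T s -> T r -> s <= r -> g s <= g r) ->
  is_derive t (1 : R) g d -> 0 <= d.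
Proof.
move=> oT Tt gm /is_derive1_caratheodory[k [kE ck <-]].
rewrite leNgt; apply/negP => k0.
have kneg : \forall y \near t, k y < 0 by have /cvgr_lt := ck; apply.
have nT : \forall y \near t, T y by exact: open_nbhs_nbhs.
have [e /= e0 eP] := filterI kneg nT.
have [ky Ty] : k (t + e / 2) < 0 /\ T (t + e / 2).
  by apply: eP; rewrite /ball_/= ltr_distlC; apply/andP; split; lra.
have := gm _ _ Tt Ty; have := kE (t + e / 2); nra.
Qed.

Lemma mxderivable_ae (T : set R) p q (Q : R -> 'M[C]_(p, q)) : open T ->
  BV_loc T Q -> {ae mu, forall t, T t -> mxderivable Q t}.
Proof.
move=> oT bv; apply: ae_open => // a b abT ab.
have : {ae mu, forall t, forall ij : 'I_p * 'I_q, a < t < b ->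
    derivable (fun s => Re (Q s ij.1 ij.2)) t 1 /\
    derivable (fun s => Im (Q s ij.1 ij.2)) t 1}.
  apply: ae_fin => -[i j] /=; have [b1 b2] := bv _ _ abT i j.
  have := ae_and (bounded_variation_ae_derivable ab b1)
                 (bounded_variation_ae_derivable ab b2).
  by apply: ae_imply => t [D1 D2] tab; split; [exact: D1|exact: D2].
by apply: ae_imply => t H tab i j; exact: (H (i, j)).
Qed.

Lemma mcont_cst (T : set R) p q (c : 'M[C]_(p, q)) : mcont T (fun=> c).
Proof. by move=> i j; split=> t _; exact: cvg_cst. Qed.

Lemma mcontM (T : set R) p q r (M : R -> 'M[C]_(p, q)) (N : R -> 'M[C]_(q, r)) :
  mcont T M -> mcont T N -> mcont T (fun t => M t *m N t).
Proof.
apply: mx_all_mulr.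
- by move=> t _; exact: cvg_cst.
- by move=> f g cf cg t Tt; apply: continuousD; [exact: cf|exact: cg].
- by move=> f cf t Tt; apply: continuousN; exact: cf.
- by move=> f g cg cf t Tt; apply: continuousM; [exact: cf|exact: cg].
Qed.

Lemma locL2_mulmx (T : set R) p q r
    (M : R -> 'M[C]_(p, q)) (N : R -> 'M[C]_(q, r)) :
  mx_all (locL2 T) M -> mcont T N -> mx_all (locL2 T) (fun t => M t *m N t).
Proof.
apply: mx_all_mulr; [|exact: locL2D|exact: locL2N|].
- by apply: continuous_locL2 => t _; exact: cvg_cst.
- by move=> f g; exact: locL2M.
Qed.

Lemma locint_mulmx (T : set R) p q r
    (M : R -> 'M[C]_(p, q)) (N : R -> 'M[C]_(q, r)) :
  mx_all (locint T) M -> mcont T N -> mx_all (locint T) (fun t => M t *m N t).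
Proof.
apply: mx_all_mulr; [exact: locint_cst|exact: locintD|exact: locintN|].
by move=> f g; exact: locintM.
Qed.

Lemma mprim_usubmx (T : set R) p1 p2 q (M dM : R -> 'M[C]_(p1 + p2, q)) :
  mprim T M dM -> mprim T (fun t => usubmx (M t)) (fun t => usubmx (dM t)).
Proof.
move=> MdM i j; under eq_fun do rewrite mxE.
by under [X in cprim _ _ X]eq_fun do rewrite mxE.
Qed.

Lemma mprim_dsubmx (T : set R) p1 p2 q (M dM : R -> 'M[C]_(p1 + p2, q)) :
  mprim T M dM -> mprim T (fun t => dsubmx (M t)) (fun t => dsubmx (dM t)).
Proof.
move=> MdM i j; under eq_fun do rewrite mxE.
by under [X in cprim _ _ X]eq_fun do rewrite mxE.
Qed.

Lemma mx_all_ctr (P : (R -> R) -> Prop) p q (M : R -> 'M[C]_(p, q)) :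
  (forall f : R -> R, P f -> P (fun t => - f t)) ->
  mx_all P M -> mx_all P (fun t => (M t)^t*).
Proof.
move=> PN HM i j; have [H1 H2] := HM j i; split.
- by under eq_fun do rewrite !mxE Re_cconj.
- by under eq_fun do rewrite !mxE Im_cconj; exact: PN.
Qed.

Lemma mx_allW (P P' : (R -> R) -> Prop) p q (M : R -> 'M[C]_(p, q)) :
  (forall f, P f -> P' f) -> mx_all P M -> mx_all P' M.
Proof. by move=> PP HM i j; have [H1 H2] := HM i j; split; exact: PP. Qed.

Lemma locint_block (T : set R) n m (A : R -> 'M[C]_n) (B : R -> 'M[C]_(n, m)) :
  mx_all (locint T) A -> mx_all (locint T) B ->
  mx_all (locint T) (fun t => block_mx (A t) (B t) 0 0 : 'M[C]_(n + m)).
Proof.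
move=> HA HB i j.
pose e t : C := match fintype.split i, fintype.split j with
  | inl k, inl l => A t k l | inl k, inr l => B t k l | _, _ => 0 end.
suff : locint T (fun t => Re (e t)) /\ locint T (fun t => Im (e t)).
  have E t : (block_mx (A t) (B t) 0 0 : 'M[C]_(n + m)) i j = e t.
    rewrite /e !mxE; case: (fintype.split i) => k; rewrite !mxE;
      by case: (fintype.split j) => l; rewrite ?mxE.
  by move=> [H1 H2]; split; under eq_fun do rewrite E.
rewrite /e; case: (fintype.split i) => k; case: (fintype.split j) => l;
  [exact: HA|exact: HB|by split; exact: locint_cst..].
Qed.

Lemma storage_KYP (n m : nat) (T : set R)
    (A : R -> 'M[C]_n) (B : R -> 'M[C]_(n, m))
    (Cm : R -> 'M[C]_(m, n)) (D : R -> 'M[C]_m) (Q : R -> 'M[C]_n) :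
  open T -> is_interval T ->
  Lp_loc 1%E T A -> Lp_loc 2%:E T B -> Lp_loc 2%:E T Cm -> Lp_loc +oo%E T D ->
  BV_loc T Q -> (forall t, T t -> psdmx (Q t)) ->
  is_storage T A B Cm D (VQ Q) -> KYP_solution T A B Cm D Q.
Proof.
move=> oT iT /Lp_loc1P HA /Lp_loc2P HB /Lp_loc2P HC /Lp_locoo HD bvQ Qpsd.
move=> [_ _ storage].
have [[t0 Tt0]|T0] := pselect (T !=set0); last first.
  by apply: aeW => t Tt; exfalso; apply: T0; exists t.
have HB1 : mx_all (locint T) B by apply: mx_allW HB => f; exact: locL2_locint.
have [X [Y [Xp XY]]] := fundamental_matrix oT iT Tt0 (locint_block HA HB1).
pose X1 t := usubmx (X t); pose U t := dsubmx (X t).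
have X1p : mprim T X1 (fun t => A t *m X1 t + B t *m U t).
  apply: eq_mprim (mprim_usubmx Xp) => t _.
  by rewrite -[X t]vsubmxK mul_block_col col_mxKu.
have cX1 : mcont T X1 := mprim_mcont oT X1p.
have cU : mcont T U := mprim_mcont oT (mprim_dsubmx Xp).
pose Y0 t := Cm t *m X1 t + D t *m U t.
have HY0 : mx_all (locL2 T) Y0.
  by apply: mx_allD; [exact: locL2D|exact: locL2_mulmx|exact: locL2_mulmx].
have HP : mx_all (locint T) (fun t => (Y0 t)^t* *m U t).
  apply: locint_mulmx => //; apply: mx_all_ctr; first exact: locintN.
  by apply: mx_allW HY0 => f; exact: locL2_locint.
(* The supplied energy is integrated once as a matrix. For every [c] it is [c^H SP c], so the null
   set where it fails to be differentiable does not depend on [c]. *)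
have [SP SPp] := mprim_exists iT HP.
pose x (c : 'cV[C]_(n + m)) t := X1 t *m c.
pose supply (c : 'cV[C]_(n + m)) t := Re ((c^t* *m SP t *m c) 0 0).
have solc c : is_solution T A B Cm D (x c) (fun t => U t *m c) (fun t => Y0 t *m c).
  split.
  - have cUc := mcontM cU (mcont_cst T c).
    by apply/Lp_loc2P; apply: mx_allW cUc => f; exact: continuous_locL2.
  - by apply/Lp_loc2P; apply: locL2_mulmx => //; exact: mcont_cst.
  exists (fun t => (A t *m X1 t + B t *m U t) *m c); split.
    by apply: mprim_W11_loc => //; exact: mprim_mulr.
  by apply: aeW => t _; rewrite /x /Y0 !mulmxDl !mulmxA.
have mono c s t : T s -> T t -> s <= t ->
    supply c s - VQ Q s (x c s) <= supply c t - VQ Q t (x c t).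
  move=> Ts Tt st; have := storage _ _ _ (solc c) _ _ Ts Tt st.
  have [[_ E] _] := mprim_mulr c (mprim_mull (c^t*) SPp) 0 0.
  have -> : \int[mu]_(r in `[s, t]) Re (((Y0 r *m c)^t* *m (U r *m c)) 0 0) =
      supply c t - supply c s.
    rewrite /supply (E _ _ (segment_sub iT Ts Tt) st); apply: eq_Rintegral => r _.
    by rewrite trmxC_mul !mulmxA.
  by move: (supply c s) (supply c t) (VQ Q s _) (VQ Q t _) => p q p' q' ?; lra.
have := ae_and (mxderivable_ae oT bvQ) (ae_and (mprim_mder oT X1p) (mprim_mder oT SPp)).
apply: ae_imply => t [dQ [dX dS]] Tt.
have {}dQ := dQ Tt; have {}dX := dX Tt; have {}dS := dS Tt; split => //.
apply: (KYP_psd_of_Re oT Tt Qpsd dQ) => x0 u0.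
(* The trajectory is chosen after [t]: it is the one that has state [x0] and input [u0] at this very
   time. *)
pose c := Y t *m col_mx x0 u0.
have Xc : X t *m c = col_mx x0 u0.
  by rewrite /c mulmxA XY// mul1mx.
have xE : X1 t *m c = x0 by rewrite /X1 mul_usub_mx Xc col_mxKu.
have uE : U t *m c = u0 by rewrite /U mul_dsub_mx Xc col_mxKd.
have dx := mderM dX (mder_cst t c).
have [dV _] := mderM (mderM (mder_ctr dx) (mxderivable_mder dQ)) dx 0 0.
have [dSc _] := mderM (mderM (mder_cst t (c^t*)) dS) (mder_cst t c) 0 0.
have dg := is_deriveB dSc (is_deriveZ (2^-1) dV).
have := is_derive_ge0 oT Tt (mono c) dg.
rewrite !mulmx0 !addr0 mul0mx add0r !mulmxDl -!mulmxA xE uE !mulmxA -trmxC_mul.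
rewrite /Y0 mulmxDl -!mulmxA xE uE !mulmxA Re_KYP_quadratic /GRing.scale/=.
by move: (Re _) (Re _) => a b; lra.
Qed.

End necessity.

(** * From the KYP inequality to storage functions *)

Section entrywise_norm.
Local Open Scope complex_scope.
Local Open Scope sesquilinear_scope.
Context {R : realType}.
Local Notation C := R[i].
Local Notation mu := (@lebesgue_measure R).
Local Notation Re := complex.Re.
Local Notation Im := complex.Im.

(** An l^1 norm over all real and imaginary parts: integrals can be estimated entry by entry, and
    submultiplicativity holds with constant 1. *)
Definition mxn p q (M : 'M[C]_(p, q)) : R :=
  \sum_i \sum_j (`|Re (M i j)| + `|Im (M i j)|).

Lemma mxn_ge0 p q (M : 'M[C]_(p, q)) : 0 <= mxn M.
Proof. by apply: sumr_ge0 => i _; apply: sumr_ge0 => j _; exact: addr_ge0. Qed.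

Lemma mxnD p q (M N : 'M[C]_(p, q)) : mxn (M + N) <= mxn M + mxn N.
Proof.
rewrite /mxn -big_split/=; apply: ler_sum => i _.
rewrite -big_split/=; apply: ler_sum => j _; rewrite mxE Re_add Im_add.
by rewrite addrACA; apply: lerD; exact: ler_normD.
Qed.

Lemma mxnN p q (M : 'M[C]_(p, q)) : mxn (- M) = mxn M.
Proof.
by apply: eq_bigr => i _; apply: eq_bigr => j _; rewrite mxE !raddfN/= !normrN.
Qed.

Lemma mxn_ctr p q (M : 'M[C]_(p, q)) : mxn (M^t*) = mxn M.
Proof.
rewrite /mxn exchange_big/=; apply: eq_bigr => i _; apply: eq_bigr => j _.
by rewrite !mxE Re_cconj Im_cconj normrN.
Qed.

Lemma mxnM p q r (M : 'M[C]_(p, q)) (N : 'M[C]_(q, r)) :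
  mxn (M *m N) <= mxn M * mxn N.
Proof.
pose e k l (A : 'M[C]_(k, l)) i j := `|Re (A i j)| + `|Im (A i j)|.
have e0 k l (A : 'M[C]_(k, l)) i j : 0 <= e k l A i j by exact: addr_ge0.
apply: (@le_trans _ _ (\sum_i \sum_j \sum_k e _ _ M i k * e _ _ N k j)).
  apply: ler_sum => i _; apply: ler_sum => j _.
  rewrite mxE !raddf_sum/=.
  apply: le_trans (lerD (ler_norm_sum _ _ _) (ler_norm_sum _ _ _)) _.
  rewrite -big_split/=; apply: ler_sum => k _; rewrite Re_mul Im_mul.
  apply: le_trans (lerD (ler_normB _ _) (ler_normD _ _)) _.
  rewrite !normrM /e le_eqVlt; apply/orP; left; apply/eqP; ring.
rewrite /mxn mulr_suml; apply: ler_sum => i _.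
rewrite mulr_suml exchange_big/=; apply: ler_sum => k _.
rewrite -mulr_sumr; apply: ler_wpM2l; first exact: e0.
rewrite (bigD1 k)//= lerDl; apply: sumr_ge0 => l _.
by apply: sumr_ge0 => j _; exact: e0.
Qed.

Lemma Re_le_mxn p q (M : 'M[C]_(p, q)) i j : `|Re (M i j)| <= mxn M.
Proof.
rewrite /mxn (bigD1 i)//= (bigD1 j)//= -!addrA lerDl !addr_ge0//.
  by apply: sumr_ge0 => k _; exact: addr_ge0.
by apply: sumr_ge0 => k _; apply: sumr_ge0 => l _; exact: addr_ge0.
Qed.

Lemma locint_mxn T p q (M : R -> 'M[C]_(p, q)) : mx_all (locint T) M ->
  locint T (fun t => mxn (M t)).
Proof.
move=> HM; apply: locint_sum => i _; apply: locint_sum => j _.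
by have [H1 H2] := HM i j; apply: locintD; exact: locint_norm.
Qed.

Lemma Rintegral_sum (T : set R) (I : Type) (k : seq I) (h : I -> R -> R) s t :
  (forall i, locint T (h i)) -> `[s, t] `<=` T ->
  \int[mu]_(r in `[s, t]) (\sum_(i <- k) h i r) =
  \sum_(i <- k) \int[mu]_(r in `[s, t]) h i r.
Proof.
move=> Hh stT; elim: k => [|i k IH].
  under eq_Rintegral do rewrite big_nil.
  by rewrite big_nil Rintegral_cst// mul0r.
under eq_Rintegral do rewrite big_cons.
rewrite big_cons -IH RintegralD//; first exact: Hh.
by have := locint_sum (P := xpredT) k (fun i _ => Hh i) stT.
Qed.

Lemma mprim_mxn_le T p q (M dM : R -> 'M[C]_(p, q)) s t : mprim T M dM ->
  `[s, t] `<=` T -> s <= t ->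
  mxn (M t - M s) <= \int[mu]_(r in `[s, t]) mxn (dM r).
Proof.
move=> MdM stT st.
have HM : mx_all (locint T) dM by move=> i j; have [[H1 _] [H2 _]] := MdM i j.
rewrite /mxn.
have Iij i j : locint T (fun r => `|Re (dM r i j)| + `|Im (dM r i j)|).
  by have [H1 H2] := HM i j; apply: locintD; exact: locint_norm.
rewrite (Rintegral_sum _ _ stT); last first.
  by move=> i; apply: locint_sum => j _; exact: Iij.
apply: ler_sum => i _; rewrite (Rintegral_sum _ _ stT)//; apply: ler_sum => j _.
have [[H1 E1] [H2 E2]] := MdM i j.
rewrite RintegralD//; [|exact: (locint_norm H1)|exact: (locint_norm H2)].
rewrite !mxE !Re_add !Im_add !raddfN/= E1// E2//.
by apply: lerD; apply: le_normr_Rintegral => //; [exact: H1|exact: H2].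
Qed.

(** Evaluating the form at [e i + w *: e j] for [w] equal to 1, -1, i and -i bounds twice the real
    part and twice the imaginary part of the entry, in absolute value, by the right-hand side. *)
Lemma psd_entry_le p (P : 'M[C]_p) i j : psdmx P ->
  `|Re (P i j)| + `|Im (P i j)| <= Re (P i i) + Re (P j j).
Proof.
move=> /psdmxP[PH P0].
pose e k : 'cV[C]_p := delta_mx k 0.
have eE k l : ((e k)^t* *m P *m e l) 0 0 = P k l.
  rewrite (_ : (e k)^t* = delta_mx 0 k).
    by rewrite -rowE -colE !mxE.
  by apply/matrixP => a b; rewrite !mxE andbC; case: andP => _; rewrite ?conjC1 ?conjC0.
have key (w : C) : 0 <= Re (P i i) + 2 * Re (w * P i j) +
    (Re w ^+ 2 + Im w ^+ 2) * Re (P j j).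
  have := P0 (e i + w *: e j).
  rewrite trmxCD trmxCZ !(mulmxDl, mulmxDr) -!(scalemxAl, scalemxAr) scalerA.
  have E (a2 a3 a4 : C) (X1 X2 X3 X4 : 'M[C]_1) :
      (X1 + a2 *: X2 + (a3 *: X3 + a4 *: X4)) 0 0 =
      X1 0 0 + a2 * X2 0 0 + (a3 * X3 0 0 + a4 * X4 0 0) by rewrite !mxE.
  have Pji : P j i = Num.conj (P i j) by rewrite -{1}PH !mxE.
  move: (eE i i) (eE i j) (eE j i) (eE j j); rewrite Pji.
  move: (_ *m _ *m e i) (_ *m _ *m e j) (_ *m _ *m e i) (_ *m _ *m e j).
  move=> X1 X2 X3 X4 E1 E2 E3 E4; rewrite E E1 E2 E3 E4.
  move: (P i i) (P j j) (P i j) => pi pj pij.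
  rewrite !(Re_add, Re_mul, Im_mul, Re_cconj, Im_cconj).
  by rewrite (_ : _ + _ + (_ + _) = Re pi + 2 * (Re w * Re pij - Im w * Im pij) +
    (Re w ^+ 2 + Im w ^+ 2) * Re pj); last by ring.
have := key (1 +i* 0); have := key ((-1) +i* 0); have := key (0 +i* 1).
have := key (0 +i* (-1)); rewrite !Re_mul /=.
move: (Re (P i j)) (Im (P i j)) (Re (P i i)) (Re (P j j)) => a b pi pj H1 H2 H3 H4.
by case: (ger0P a) => a0; case: (ger0P b) => b0; lra.
Qed.

(** The factor [2 * p] comes from summing the entry bound over all pairs of indices. Since the trace
    is additive, this converts Loewner monotonicity into control of norms by a monotone scalar
    function. *)
Lemma psd_mxn_le p (P : 'M[C]_p) : psdmx P ->
  mxn P <= 2 * p%:R * \sum_i Re (P i i).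
Proof.
move=> Ppsd; apply: (@le_trans _ _ (\sum_i \sum_j (Re (P i i) + Re (P j j)))).
  by apply: ler_sum => i _; apply: ler_sum => j _; exact: psd_entry_le.
under eq_bigr do rewrite big_split/= sumr_const card_ord.
rewrite big_split/= sumr_const card_ord sumrMnl.
by rewrite -[X in X + X]mulr_natr; move: (\sum_i _) => r; lra.
Qed.

(** Almost everywhere [g - f] coincides with its absolute value, the two endpoints being a null set,
    and the latter has a nonnegative integral. *)
Lemma ae_le_Rintegral (f g : R -> R) (a b : R) :
  mu.-integrable `[a, b] (EFin \o f) -> mu.-integrable `[a, b] (EFin \o g) ->
  {ae mu, forall t, a < t < b -> f t <= g t} ->
  \int[mu]_(t in `[a, b]) f t <= \int[mu]_(t in `[a, b]) g t.
Proof.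
move=> fi gi fg; rewrite -subr_ge0 -RintegralB//.
have gfi := integrableB _ gi fi.
have mgf : measurable_fun `[a, b] (fun t => g t - f t).
  by apply/measurable_EFinP; exact: measurable_int (gfi (measurable_itv _)).
have -> : \int[mu]_(t in `[a, b]) (g t - f t) =
    \int[mu]_(t in `[a, b]) `|g t - f t|.
  congr fine; apply: ae_eq_integral => //.
  - exact/measurable_EFinP.
  - by apply/measurable_EFinP; exact: measurableT_comp.
  have ne c : {ae mu, forall t, t != c}.
    exists [set c]; split => //; first exact: lebesgue_measure_set1.
    by move=> t /= /negP; rewrite negbK => /eqP.
  have := ae_and fg (ae_and (ne a) (ne b)).
  apply: ae_imply => t [ft [ta tb]]; rewrite /= in_itv/= => /andP[at_ tb'].
  by rewrite ger0_norm// subr_ge0 ft// !lt_neqAle eq_sym ta tb at_.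
exact: Rintegral_ge0.
Qed.

End entrywise_norm.

(** * The storage inequality along a trajectory *)

Section sufficiency.
Local Open Scope complex_scope.
Local Open Scope sesquilinear_scope.
Context {R : realType}.
Local Notation C := R[i].
Local Notation mu := (@lebesgue_measure R).
Local Notation Re := complex.Re.
Local Notation Im := complex.Im.

Lemma Re_mxn_le p (M : 'M[C]_p) i (b : R) : mxn M <= b -> Re (M i i) <= b.
Proof. by apply: le_trans; apply: le_trans (ler_norm _) (Re_le_mxn _ _ _). Qed.

Lemma mxnM3 p q r l (M : 'M[C]_(p, q)) (N : 'M[C]_(q, r)) (P : 'M[C]_(r, l))
    (a b c : R) :
  mxn M <= a -> mxn N <= b -> mxn P <= c -> mxn (M *m N *m P) <= a * b * c.
Proof.
move=> Ma Nb Pc; apply: le_trans (mxnM _ _) _.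
apply: ler_pM => //; [exact: mxn_ge0|exact: mxn_ge0|].
apply: le_trans (mxnM _ _) _.
by apply: ler_pM => //; exact: mxn_ge0.
Qed.

(** The change of the matrix at a fixed vector is separated from the change of the vector at a fixed
    matrix. The cross terms [x^H Q z] and [z^H Q x] cancel in the real part because [Q] is
    Hermitian. *)
Lemma Re_quadratic_increment p (P Q : 'M[C]_p) (x z : 'cV[C]_p) : Q^t* = Q ->
  Re ((x^t* *m P *m x) 0 0) - Re ((z^t* *m Q *m z) 0 0) =
  Re ((x^t* *m (P - Q) *m x) 0 0) + Re (((x - z)^t* *m Q *m (x + z)) 0 0).
Proof.
move=> QH.
have E : Re ((x^t* *m Q *m z) 0 0) = Re ((z^t* *m Q *m x) 0 0).
  by rewrite -Re_ctr !trmxC_mul trmxCK QH mulmxA.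
have -> : (x - z)^t* = x^t* - z^t* by rewrite -scaleN1r trmxCD trmxCZ rmorphN1 scaleN1r.
rewrite !(mulmxBl, mulmxBr, mulmxDr).
move: (_ *m P *m _) (x^t* *m Q *m x) (x^t* *m Q *m z) (z^t* *m Q *m x) (_ *m _ *m z) E.
by move=> a b c d e E; rewrite !(Re_submx, Re_addmx) E; ring.
Qed.

(* [Q s], [x t] and [x s] are frozen in the integrand over [s, t]; the price of
   comparing them with the values at the current time [r] is of second order. *)
Lemma frozen_integrand_le p (x z w d : 'cV[C]_p) (P Q G : 'M[C]_p) (s b c e e1 : R) :
  P^t* = P -> mxn x <= b -> mxn w <= b -> mxn Q <= c ->
  mxn (x - w) <= e -> mxn (z - w) <= e -> mxn (P - Q) <= e1 ->
  0 <= 2 * s - Re ((d^t* *m P *m w + w^t* *m G *m w + w^t* *m P *m d) 0 0) ->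
  Re ((x^t* *m G *m x) 0 0) + Re ((d^t* *m (Q *m (x + z))) 0 0) <=
  2 * s + 2 * b * e * mxn G + (2 * c * e + 2 * b * e1) * mxn d.
Proof.
move=> PH xb wb Qc xe ze PQ.
have E : Re ((w^t* *m P *m d) 0 0) = Re ((d^t* *m P *m w) 0 0).
  by rewrite -Re_ctr !trmxC_mul trmxCK PH mulmxA.
have -> : x^t* *m G *m x =
    w^t* *m G *m w + ((x - w)^t* *m G *m x + w^t* *m G *m (x - w)).
  have -> : (x - w)^t* = x^t* - w^t* by rewrite -scaleN1r trmxCD trmxCZ rmorphN1 scaleN1r.
  rewrite !(mulmxBl, mulmxBr).
  move: (x^t* *m G *m x) (w^t* *m G *m x) (w^t* *m G *m w) => a1 a2 a3.
  by apply/matrixP => i j; rewrite !mxE; ring.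
have -> : d^t* *m (Q *m (x + z)) = d^t* *m P *m w + d^t* *m P *m w +
    (d^t* *m Q *m (x - w) + d^t* *m Q *m (z - w) +
     (d^t* *m - (P - Q) *m w + d^t* *m - (P - Q) *m w)).
  rewrite opprB !(mulmxBl, mulmxBr, mulmxDr) !mulmxA.
  move: (_ *m _ *m x) (_ *m _ *m z) (_ *m P *m w) (_ *m Q *m w) => a1 a2 a3 a4.
  by apply/matrixP => i j; rewrite !mxE; ring.
have db : mxn (d^t*) <= mxn d by rewrite mxn_ctr.
have xec : mxn ((x - w)^t*) <= e by rewrite mxn_ctr.
have wbc : mxn (w^t*) <= b by rewrite mxn_ctr.
have PQ' : mxn (- (P - Q)) <= e1 by rewrite mxnN.
have := Re_mxn_le 0 (mxnM3 xec (lexx (mxn G)) xb).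
have := Re_mxn_le 0 (mxnM3 wbc (lexx (mxn G)) xe).
have := Re_mxn_le 0 (mxnM3 db Qc xe).
have := Re_mxn_le 0 (mxnM3 db Qc ze).
have := Re_mxn_le 0 (mxnM3 db PQ' wb).
move: E.
move: (d^t* *m - (P - Q) *m w) (d^t* *m Q *m (z - w)) (d^t* *m Q *m (x - w)).
move: (w^t* *m G *m (x - w)) ((x - w)^t* *m G *m x) (w^t* *m P *m d).
move: (d^t* *m P *m w) (w^t* *m G *m w) => a1 a2 a3 a4 a5 a6 a7 a8.
rewrite !Re_addmx; move: (mxn G) (mxn d) => g h.
move: (Re (a1 0 0)) (Re (a2 0 0)) (Re (a3 0 0)) (Re (a4 0 0)) (Re (a5 0 0)).
by move: (Re (a6 0 0)) (Re (a7 0 0)) (Re (a8 0 0)) => *; lra.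
Qed.

Lemma is_interval_segment (a b : R) : is_interval (`[a, b] : set R).
Proof.
move=> s t /= + + r; rewrite !in_itv/= => /andP[as_ _] /andP[_ tb] /andP[sr rt].
by rewrite (le_trans as_) ?(le_trans rt).
Qed.

Lemma locint_supply T m (u y : R -> 'cV[C]_m) :
  mx_all (locL2 T) u -> mx_all (locL2 T) y ->
  locint T (fun t => Re (((y t)^t* *m u t) 0 0)).
Proof.
move=> Hu Hy.
have -> : (fun t => Re (((y t)^t* *m u t) 0 0)) = (fun t =>
    \sum_k (Re (y t k 0) * Re (u t k 0) + Im (y t k 0) * Im (u t k 0))).
  apply/funext => t; rewrite Re_mulmx; apply: eq_bigr => k _.
  by rewrite !mxE Re_cconj Im_cconj mulNr opprK.
apply: locint_sum => k _; have [u1 u2] := Hu k 0; have [y1 y2] := Hy k 0.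
by apply: locintD; exact: locL2_mul.
Qed.

Lemma prim_sub (S T : set R) (F f : R -> R) : S `<=` T -> prim T F f -> prim S F f.
Proof.
move=> ST [fT Ff]; split=> [a b /subset_trans/(_ ST)|a b /subset_trans/(_ ST)].
  exact: fT.
exact: Ff.
Qed.

Lemma VQ_ge0 n (Q : R -> 'M[C]_n) t v : psdmx (Q t) -> 0 <= VQ Q t v.
Proof. by move=> /psdmxP[_ Q0]; rewrite /VQ mulr_ge0// invr_ge0. Qed.

Lemma VQ0 n (Q : R -> 'M[C]_n) t : VQ Q t 0 = 0.
Proof. by rewrite /VQ mulmx0 mxE mulr0. Qed.

Lemma KYP_storage_inequality (n m : nat) (T : set R)
    (A : R -> 'M[C]_n) (B : R -> 'M[C]_(n, m))
    (Cm : R -> 'M[C]_(m, n)) (D : R -> 'M[C]_m) (Q : R -> 'M[C]_n)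
    (x : R -> 'cV[C]_n) (u y : R -> 'cV[C]_m) (t0 t1 : R) :
  open T -> is_interval T -> AUC t0 t1 Q -> (forall t, T t -> psdmx (Q t)) ->
  KYP_solution T A B Cm D Q -> is_solution T A B Cm D x u y ->
  T t0 -> T t1 -> t0 <= t1 ->
  VQ Q t1 (x t1) - VQ Q t0 (x t0) <=
    \int[mu]_(t in `[t0, t1]) Re (((y t)^t* *m u t) 0 0).
Proof.
move=> oT iT [_ [G [GL1 GQ GI]]] Qpsd kyp.
move=> [/Lp_loc2P Hu /Lp_loc2P Hy [dx [/(W11_loc_mprim oT iT) xp eqs]]] Tt0 Tt1 t01.
have IT := segment_sub iT Tt0 Tt1.
have QH t : T t -> (Q t)^t* = Q t by move=> /Qpsd/psdmxP[].
pose S : set R := `[t0, t1]%classic.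
have iS : is_interval S := @is_interval_segment t0 t1.
have St0 : S t0 by rewrite /S/= in_itv/= lexx.
have segS s t : t0 <= s -> t <= t1 -> `[s, t] `<=` S.
  by move=> ts tt; exact: sub_segment ts tt.
have HG : mx_all (locint S) G.
  move=> i j; have [/Lfun1_segment H1 /Lfun1_segment H2] := GL1 i j.
  by split=> a b abS; [apply: integrableS H1|apply: integrableS H2].
(* [N] is the absolutely continuous companion of [Q], built on the closed segment where [G] is known
   to be integrable. *)
have [N Np] := mprim_exists iS HG.
have [vg vgp _] := prim_exists iS St0 (locint_mxn HG).
have Hdx : mx_all (locint T) dx by move=> i j; have [[H1 _] [H2 _]] := xp i j.
have [wx wxp _] := prim_exists iT Tt0 (locint_mxn Hdx).
have Hs := locint_supply Hu Hy.
have [sp spp _] := prim_exists iT Tt0 Hs.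
have NE r s : t0 <= r -> r <= s -> s <= t1 -> mxintegral r s G = N s - N r.
  move=> tr rs st; apply/matrixP => i j; have [[_ E1] [_ E2]] := Np i j.
  rewrite !mxE; have rsS := segS _ _ tr st.
  by rewrite -E1// -E2//; apply/eqP; rewrite eq_complex/= Re_add Im_add !raddfN/= !eqxx.
have Zpsd r s : t0 <= r -> r <= s -> s <= t1 ->
    psdmx ((N s - N r) - (Q s - Q r)).
  by move=> tr rs st; rewrite -NE//; exact: GI.
(* By [Zpsd] this trace is nondecreasing, and with the factor [k] taken from [psd_mxn_le] its
   increments dominate the norm of those of [N - Q]. *)
pose tau t := \sum_i Re ((N t - Q t) i i).
pose k : R := 2 * n%:R.
have F1 r s : t0 <= r -> r <= s -> s <= t1 -> mxn (x s - x r) <= wx s - wx r.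
  move=> tr rs st; have rsT := sub_segment IT tr st.
  by rewrite (wxp.2 _ _ rsT rs); exact: mprim_mxn_le.
have F2 r s : t0 <= r -> r <= s -> s <= t1 -> mxn (N s - N r) <= vg s - vg r.
  move=> tr rs st; have rsS := segS _ _ tr st.
  by rewrite (vgp.2 _ _ rsS rs); exact: mprim_mxn_le Np rsS rs.
(* Increments of [Q] are estimated through [N]: [vg] measures the absolutely continuous part and
   [k * tau] the singular part. *)
pose v1 t := vg t + k * tau t.
have F3 r s : t0 <= r -> r <= s -> s <= t1 -> mxn (Q s - Q r) <= v1 s - v1 r.
  move=> tr rs st.
  have -> : Q s - Q r = (N s - N r) - ((N s - N r) - (Q s - Q r)).
    by rewrite subKr.
  apply: le_trans (mxnD _ _) _; rewrite mxnN.
  have -> : v1 s - v1 r = (vg s - vg r) + k * (tau s - tau r) by rewrite /v1; ring.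
  apply: lerD; first exact: F2.
  apply: le_trans (psd_mxn_le (Zpsd _ _ tr rs st)) _.
  rewrite /tau -sumrB le_eqVlt; apply/orP; left; apply/eqP; congr (_ * _).
  by apply: eq_bigr => i _; rewrite !mxE !(Re_add, raddfN)/= !Re_add !raddfN/=; ring.
pose bx := mxn (x t0) + (wx t1 - wx t0).
pose bq := mxn (Q t0) + (v1 t1 - v1 t0).
have wxm r s : t0 <= r -> r <= s -> s <= t1 -> wx r <= wx s.
  by move=> tr rs st; rewrite -subr_ge0; apply: le_trans (F1 _ _ tr rs st); exact: mxn_ge0.
have vgm r s : t0 <= r -> r <= s -> s <= t1 -> vg r <= vg s.
  by move=> tr rs st; rewrite -subr_ge0; apply: le_trans (F2 _ _ tr rs st); exact: mxn_ge0.
have v1m r s : t0 <= r -> r <= s -> s <= t1 -> v1 r <= v1 s.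
  by move=> tr rs st; rewrite -subr_ge0; apply: le_trans (F3 _ _ tr rs st); exact: mxn_ge0.
have bx_ge r : t0 <= r -> r <= t1 -> mxn (x r) <= bx.
  move=> tr rt; rewrite -[x r](subrKC (x t0)); apply: le_trans (mxnD _ _) _.
  by rewrite /bx lerD2l; apply: le_trans (F1 _ _ (lexx _) tr rt) _; rewrite lerD2r; exact: wxm.
have bq_ge r : t0 <= r -> r <= t1 -> mxn (Q r) <= bq.
  move=> tr rt; rewrite -[Q r](subrKC (Q t0)); apply: le_trans (mxnD _ _) _.
  by rewrite /bq lerD2l; apply: le_trans (F3 _ _ (lexx _) tr rt) _; rewrite lerD2r; exact: v1m.
have bx0 : 0 <= bx by apply: le_trans (bx_ge _ (lexx _) t01); exact: mxn_ge0.
have bq0 : 0 <= bq by apply: le_trans (bq_ge _ (lexx _) t01); exact: mxn_ge0.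
clearbody v1 bx bq.
have arith (qt qs dq mt ms nt ns spt sps vgt vgs wt ws vt vs : R) :
    qt - qs = dq + (mt - ms) -> 0 <= nt - ns - dq ->
    nt + mt - (ns + ms) <=
      2 * spt + 2 * bx * (wt - ws) * vgt +
        (2 * bq * (wt - ws) + 2 * bx * (vt - vs)) * wt -
      (2 * sps + 2 * bx * (wt - ws) * vgs +
        (2 * bq * (wt - ws) + 2 * bx * (vt - vs)) * ws) ->
    2^-1 * qt - spt - (2^-1 * qs - sps) <=
    (wt - ws) * ((bx * vgt + bq * wt + bx * vt) - (bx * vgs + bq * ws + bx * vs)).
  by move=> *; lra.
(* All three errors contain the increment of [wx], which is continuous; [v] collects the cofactors,
   due in this order to moving [x] in the [G] term, moving [x] in the [dx] term and moving [Q]. *)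
pose v t := bx * vg t + bq * wx t + bx * v1 t.
suff : VQ Q t1 (x t1) - sp t1 <= VQ Q t0 (x t0) - sp t0.
  rewrite -(spp.2 _ _ IT t01).
  by move: (VQ _ _ _) (VQ _ _ _) (sp t0) (sp t1) => a b c d ?; lra.
apply: (@le_of_quadratic_increments _ (fun t => VQ Q t (x t) - sp t) v wx t0 t1 t01).
- by move=> t tS; apply: (prim_continuous oT wxp); rewrite inE; exact: IT.
- move=> s t; rewrite !in_itv/= => /andP[ts st] /andP[tt t1t] s_t; exact: wxm.
- move=> s t; rewrite !in_itv/= => /andP[ts st] /andP[tt t1t] s_t.
  by rewrite /v !lerD// ler_wpM2l//; [exact: vgm|exact: wxm|exact: v1m].
move=> s t ts st tt.
have stS := segS _ _ ts tt; have stT := sub_segment IT ts tt.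
pose e := wx t - wx s; pose e1 := v1 t - v1 s.
have ST : S `<=` T := IT.
(* With [x t], [x s] and [Q s] frozen, both integrands are densities of linear images of [N] and
   [x], so their integrals are exact increments. *)
have p1 := (mprim_mulr (x t) (mprim_mull ((x t)^t*) Np) 0 0).1.
have p2 := prim_sub ST (mprim_mulr (Q s *m (x t + x s)) (mprim_ctr xp) 0 0).1.
have pl := primD p1 p2.
have pr := primD (primD (primZ 2 (prim_sub ST spp)) (primZ (2 * bx * e) vgp))
  (primZ (2 * bq * e + 2 * bx * e1) (prim_sub ST wxp)).
have := ae_le_Rintegral (pl.1 _ _ stS) (pr.1 _ _ stS).
rewrite -(pl.2 _ _ stS st) -(pr.2 _ _ stS st).
have key : {ae mu, forall r, s < r < t ->
    Re (((x t)^t* *m G r *m x t) 0 0) +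
    Re (((dx r)^t* *m (Q s *m (x t + x s))) 0 0) <=
    2 * Re (((y r)^t* *m u r) 0 0) + 2 * bx * e * mxn (G r) +
    (2 * bq * e + 2 * bx * e1) * mxn (dx r)}.
  apply: ae_imply (ae_and GQ (ae_and kyp eqs)) => r [Gr [kr er]] /andP[sr rt].
  have t0r : t0 <= r by exact: le_trans ts (ltW sr).
  have rt1 : r <= t1 by exact: le_trans (ltW rt) tt.
  have Tr : T r by apply: IT; rewrite /= in_itv/= t0r.
  have [_ dQr] : mxderivable Q r /\ mxderiv Q r = G r.
    by apply: Gr; rewrite (le_lt_trans ts sr) (lt_le_trans rt tt).
  have [dxE yE] := er Tr; have [_ /psdmxP[_ K0]] := kr Tr.
  apply: (@frozen_integrand_le _ _ _ (x r) _ (Q r)).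
  - exact: QH.
  - by apply: bx_ge => //; exact: le_trans ts st.
  - exact: bx_ge.
  - by apply: bq_ge => //; exact: le_trans st tt.
  - apply: le_trans (F1 _ _ t0r (ltW rt) tt) _.
    by rewrite /e lerD2l lerN2; apply: wxm => //; exact: ltW.
  - rewrite -opprB mxnN; apply: le_trans (F1 _ _ ts (ltW sr) rt1) _.
    by rewrite /e lerD2r; apply: wxm => //; exact: ltW.
  - apply: le_trans (F3 _ _ ts (ltW sr) rt1) _.
    by rewrite /e1 lerD2r; apply: v1m => //; exact: ltW.
  - by have := K0 (col_mx (x r) (u r)); rewrite Re_KYP_quadratic -dxE -yE dQr.
move=> /(_ key).
have Ts : T s by apply: IT; rewrite /= in_itv/= ts; exact: le_trans st tt.
have inc := @Re_quadratic_increment _ (Q t) (Q s) (x t) (x s) (QH _ Ts).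
(* Upper semicontinuity enters at the single vector [x t]: the form of [Q t - Q s] is at most that
   of [N t - N s]. *)
have [_ /(_ (x t))] := (psdmxP _).1 (Zpsd _ _ ts st tt).
have -> : (x t)^t* *m (N t - N s - (Q t - Q s)) *m x t =
    (x t)^t* *m N t *m x t - (x t)^t* *m N s *m x t - (x t)^t* *m (Q t - Q s) *m x t.
  by rewrite mulmxBr mulmxBl (mulmxBr _ (N t)) (mulmxBl _ _ (x t)).
rewrite (Re_submx (_ - _)) (Re_submx (_ *m N t *m _)) => Z.
move: inc.
have -> : (x t - x s)^t* *m Q s *m (x t + x s) =
    (x t)^t* *m (Q s *m (x t + x s)) - (x s)^t* *m (Q s *m (x t + x s)).
  by rewrite -scaleN1r trmxCD trmxCZ rmorphN1 scaleN1r -mulmxA mulmxBl.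
rewrite (Re_submx (_ *m (Q s *m _))) => inc ineq; exact: arith inc Z ineq.
Qed.

Lemma KYP_storage (n m : nat) (T : set R)
    (A : R -> 'M[C]_n) (B : R -> 'M[C]_(n, m))
    (Cm : R -> 'M[C]_(m, n)) (D : R -> 'M[C]_m) (Q : R -> 'M[C]_n) :
  open T -> is_interval T -> AUC_loc T Q -> (forall t, T t -> psdmx (Q t)) ->
  KYP_solution T A B Cm D Q -> is_storage T A B Cm D (VQ Q).
Proof.
move=> oT iT aucQ Qpsd kyp; split=> [t v Tt|t _|x u y sol t0 t1 Tt0 Tt1 t01].
- exact/VQ_ge0/Qpsd.
- exact: VQ0.
- apply: (KYP_storage_inequality oT iT _ Qpsd kyp sol) => //.
  by apply: aucQ; exact: segment_sub.
Qed.

End sufficiency.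

Theorem corollary5p6 (R : realType) (n m : nat) (T : set R)
    (A : R -> 'M[R[i]]_n) (B : R -> 'M[R[i]]_(n, m))
    (C : R -> 'M[R[i]]_(m, n)) (D : R -> 'M[R[i]]_m)
    (openT : open T) (itvT : is_interval T)
    (A_L1 : Lp_loc 1%E T A) (B_L2 : Lp_loc 2%:E T B)
    (C_L2 : Lp_loc 2%:E T C) (D_Loo : Lp_loc +oo%E T D) :
  (forall Q : R -> 'M[R[i]]_n,
     BV_loc T Q -> (forall t, T t -> psdmx (Q t)) ->
     is_storage T A B C D (VQ Q) -> KYP_solution T A B C D Q) /\
  (forall Q : R -> 'M[R[i]]_n,
     AUC_loc T Q -> (forall t, T t -> psdmx (Q t)) ->
     KYP_solution T A B C D Q -> is_storage T A B C D (VQ Q)).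
Proof.
split=> Q; [exact: storage_KYP|exact: KYP_storage].
Qed.
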